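(* Let $\alpha,\beta>0$, $\mu_1,\mu_2\in\mathbb{R}$, $\sigma_1,\sigma_2>0$, and let $X\sim GGD(\mu_1,\sigma_1,\alpha)$ and $Y\sim GGD(\mu_2,\sigma_2,\beta)$ be independent. Put $Z=X+Y$ and $\mu=\mu_1+\mu_2$. Then for every $z\neq\mu$ the density of $Z$ is $$f_Z(z)=\frac{\sqrt{\pi}}{\Gamma(1/\alpha)\Gamma(1/\beta)\,|z-\mu|}\;\mathcal{G}_0\!\left(\frac{\sigma_1^2\Gamma(1/\alpha)}{\Gamma(3/\alpha)(z-\mu)^2},\ \frac{\sigma_2^2\Gamma(1/\beta)}{\Gamma(3/\beta)(z-\mu)^2}\right),$$ where $\mathcal{G}_0(x,y)={\rm H}^{0,1;1,1;1,1}_{2,0;1,2;1,2}\!\left[x,y\,\middle|\,\begin{matrix}(\tfrac12;1,1),(0;1,1)\\ -\end{matrix}\,\middle|\,\begin{matrix}(1-\tfrac1\alpha,\tfrac2\alpha)\\(0,1),(\tfrac12,1)\end{matrix}\,\middle|\,\begin{matrix}(1-\tfrac1\beta,\tfrac2\beta)\\(0,1),(\tfrac12,1)\end{matrix}\right]$, i.e. $$\mathcal{G}_0(x,y)=\frac{1}{(2\pi i)^2}\int_{L_1}\int_{L_2}\frac{\Gamma(\tfrac12+s+u)}{\Gamma(-s-u)}\,\theta_\alpha(s)\,\theta_\beta(u)\,x^s y^u\,du\,ds .$$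
   Context: For $\alpha>0$, $\mu\in\mathbb{R}$, $\sigma>0$, a random variable $X\sim GGD(\mu,\sigma,\alpha)$ (generalized Gaussian) has density $f_X(x)=\frac{\alpha\Lambda}{2\Gamma(1/\alpha)}\exp(-\Lambda^\alpha|x-\mu|^\alpha)$, $x\in\mathbb{R}$, where $\Lambda=\frac{1}{\sigma}\sqrt{\Gamma(3/\alpha)/\Gamma(1/\alpha)}$. For $\alpha>0$ set $\theta_\alpha(s)=\frac{\Gamma(-s)\,\Gamma\left(\frac1\alpha+\frac{2s}{\alpha}\right)}{\Gamma\left(\frac12+s\right)}$. The bivariate Fox H-function (in the sense of Mittal and Gupta) is defined by ${\rm H}^{0,n_1;m_2,n_2;m_3,n_3}_{p_1,q_1;p_2,q_2;p_3,q_3}[x,y\mid (a_j;\alpha_j,A_j)_{1}^{p_1}:(b_j;\beta_j,B_j)_1^{q_1}\mid (c_j,\gamma_j)_1^{p_2};(d_j,\delta_j)_1^{q_2}\mid (e_j,E_j)_1^{p_3};(f_j,F_j)_1^{q_3}]=\frac{1}{(2\pi i)^2}\int_{L_1}\int_{L_2}\phi(s,u)\theta_2(s)\theta_3(u)x^sy^u\,du\,ds$, where $\phi(s,u)=\frac{\prod_{j=1}^{n_1}\Gamma(1-a_j+\alpha_js+A_ju)}{\prod_{j=n_1+1}^{p_1}\Gamma(a_j-\alpha_js-A_ju)\prod_{j=1}^{q_1}\Gamma(1-b_j+\beta_js+B_ju)}$, $\theta_2(s)=\frac{\prod_{j=1}^{m_2}\Gamma(d_j-\delta_js)\prod_{j=1}^{n_2}\Gamma(1-c_j+\gamma_js)}{\prod_{j=m_2+1}^{q_2}\Gamma(1-d_j+\delta_js)\prod_{j=n_2+1}^{p_2}\Gamma(c_j-\gamma_js)}$,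 $\theta_3$ analogously with $(e_j,E_j),(f_j,F_j),m_3,n_3$, and $L_1,L_2$ are suitable Mellin–Barnes contours in the $s$- and $u$-planes separating the increasing and decreasing sequences of poles of the gamma factors. In the notation above, the upper row of each bracket lists the ''numerator-type'' parameters $(a_j)$, $(c_j)$, $(e_j)$ and the lower row the parameters $(b_j)$, $(d_j)$, $(f_j)$; ''$-$'' denotes an empty list. *)

(* Defs.v *)
From HB Require Import structures.
From mathcomp Require Import all_boot all_order all_algebra.
From mathcomp Require Import all_classical all_reals all_analysis.
From mathcomp Require Import complex.
Set Implicit Arguments. Unset Strict Implicit. Unset Printing Implicit Defensive.
Import Order.TTheory GRing.Theory Num.Theory.
Import numFieldNormedType.Exports.
Local Open Scope classical_set_scope.
Local Open Scope ring_scope.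
Local Open Scope complex_scope.

Section GGD.
Variable R : realType.
Local Notation C := R[i].

Definition Gamma (x : R) : R :=
  Rintegral lebesgue_measure `]0, +oo[%classic (fun t => t `^ (x - 1) * expR (- t)).

Definition cpow (x : R) (s : C) : C :=
  ((expR (complex.Re s * ln x))%:C *
   ((cos (complex.Im s * ln x)) +i* (sin (complex.Im s * ln x))))%C.

(* Euler/Gauss product: n! n^s / (s (s+1) ... (s+n)). *)
Definition Gamma_seq (s : C) (n : nat) : C :=
  (((n.+1)`!)%:R * cpow (n.+1)%:R s / \prod_(k < n.+2) (s + (k%:R)%:C))%C.

(* Complex Gamma function (meromorphic; value irrelevant at its poles). *)
Definition cGamma (s : C) : C :=
  (limn (fun n => complex.Re (Gamma_seq s n)) +i*
   limn (fun n => complex.Im (Gamma_seq s n)))%C.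

Definition cRint (f : R -> C) : C :=
  (Rintegral lebesgue_measure setT (fun t => complex.Re (f t)) +i*
   Rintegral lebesgue_measure setT (fun t => complex.Im (f t)))%C.

Definition ggd_Lambda (sigma a : R) : R :=
  sigma^-1 * Num.sqrt (Gamma (3 / a) / Gamma (1 / a)).

Definition ggd_pdf (mu sigma a : R) (x : R) : R :=
  a * ggd_Lambda sigma a / (2 * Gamma (1 / a)) *
  expR (- (ggd_Lambda sigma a `^ a * `|x - mu| `^ a)).

Definition theta (a : R) (s : C) : C :=
  (cGamma (- s) * cGamma ((1 / a)%:C + (2 / a)%:C * s) /
   cGamma ((1 / 2)%:C + s))%C.

Definition G0_integrand (a b x y : R) (s u : C) : C :=
  (cGamma ((1 / 2)%:C + s + u) / cGamma (- s - u) *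
   theta a s * theta b u * cpow x s * cpow y u)%C.

(* G_0(x,y) with contours L1 = c1 + i R (in s) and L2 = c2 + i R (in u):
   1/(2 pi i)^2 * int_{L1} int_{L2} ... du ds
   = 1/(4 pi^2) * int_R int_R integrand(c1 + i t, c2 + i tau) dtau dt. *)
Definition G0 (a b c1 c2 x y : R) : C :=
  ((4 * pi ^+ 2)^-1)%:C *
  cRint (fun t => cRint (fun tau =>
    G0_integrand a b x y (c1 +i* t)%C (c2 +i* tau)%C)).

End GGD.

Definition indep_RV {d} {T : measurableType d} {R : realType}
  (P : probability T R) (X Y : T -> R) : Prop :=
  forall A B : set R, measurable A -> measurable B ->
    P (X @^-1` A `&` Y @^-1` B) = (P (X @^-1` A) * P (Y @^-1` B))%E.

Definition has_density {d} {T : measurableType d} {R : realType}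
  (P : probability T R) (X : T -> R) (f : R -> R) : Prop :=
  forall A : set R, measurable A ->
    P (X @^-1` A) = (\int[lebesgue_measure]_(x in A) (f x)%:E)%E.

(* Main.v *)
Require Import Defs.
From HB Require Import structures.
From mathcomp Require Import all_boot all_order all_algebra.
From mathcomp Require Import all_classical all_reals all_analysis.
From mathcomp Require Import complex measurable_realfun ring lra.
Import Order.TTheory GRing.Theory Num.Theory.
Import numFieldNormedType.Exports.
Local Open Scope classical_set_scope.
Local Open Scope ring_scope.
Local Open Scope complex_scope.
Set Implicit Arguments. Unset Strict Implicit. Unset Printing Implicit Defensive.

(* The density of [Z] is the convolution of the two densities. Write [g(x) = e^(-|L x|^a)] as a Mellin-Barnes integral of [|x|^(-1-2s)] against [Gamma(1/a + 2s/a) L^(-1-2s)]: this is Mellin inversion of the Gamma function, obtained as the limit of its Poisson regularisation (damping by [e^(-e|t|)] and letting [e] tend to 0). By Fubini the convolution becomes a double contour integral of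
     [int |x|^(-1-2s) |v-x|^(-1-2u) dx]
   which is computed by Feynman parametrisation: a beta integral merges the two powers into a single power of a quadratic polynomial in [x], whose integral is a Cauchy-type integral, and the remaining parameter integral is again a beta integral. The result is the ratio of Gamma functions in the kernel of [G0].
   The complex Gamma function is defined by Gauss's product; it agrees with Euler's integral because their quotient is [E[(X/n)^s]] for [X] Gamma-distributed with parameter [n + 1], which tends to 1 by comparison with integer moments. *)

(** * Integration on the real line *)

(** The conditions [-1/2 < c1 < 0], [-1/2 < c2 < 0], [-1/2 < c1 + c2] act in two ways. They give
    convergence of the inner integral (integrability at [0], at [v] and at infinity), and they give
    positive real part to all eight Gamma arguments of the kernel, so that [cGamma] has to be
    compared with Euler's integral on the right half-plane only. Gamma and Beta integrals are
    written in a logarithmic variable over the whole line: powers become exponentials [cexp], and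
    rescaling the variable becomes a translation. The obstacle is the exchange of integrals. With
    Euler's integral inserted, the inversion integral is not absolutely convergent, because the
    modulus of the integrand does not depend on [t]; this is what the damping repairs. In the other
    exchanges absolute convergence holds: on vertical lines Gamma decays quadratically, which two
    uses of the functional equation already give, and the modulus of [|x|^(-1-2s)] depends only on
    the real part of [s], so the majorants are products of functions of one variable. *)

Section RealLine.
Variable R : realType.
Implicit Types f g : R -> R.
Notation mu := (@lebesgue_measure R).

Definition integ (f : R -> R) : Prop := mu.-integrable setT (EFin \o f).
Definition rint (f : R -> R) : R := Rintegral mu setT f.
Definition meas (f : R -> R) : Prop := measurable_fun setT f.

Lemma affine_meas (a b : R) : measurable_fun setT (fun x : R => a * x + b).
Proof. by apply: measurable_funD => //; exact: measurable_funM. Qed.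

Let affine_measT (a b : R) : measurable_fun setT
  (fun x : measurableTypeR R => (a * x + b)%R : measurableTypeR R).
Proof. exact: affine_meas. Qed.

(** By uniqueness of Lebesgue measure it is enough to compare both sides on intervals []u, v]]. When
    [a < 0] the preimage is closed on the left and open on the right, which leaves the length
    unchanged. *)
Lemma lebesgue_affine (a b : R) (A : set R) : a != 0 -> measurable A ->
  mu A = (`|a|%:E * mu ((fun x => a * x + b)%R @^-1` A))%E.
Proof.
move=> a0 mA.
pose phi : {mfun measurableTypeR R >-> measurableTypeR R} :=
  HB.pack (fun x : measurableTypeR R => (a * x + b)%R : measurableTypeR R)
   (isMeasurableFun.Build _ _ _ _ _ (affine_measT a b)).
pose a' : {nonneg R} := NngNum (normr_ge0 a).
rewrite (@lebesgue_measure_unique R (mscale a' (pushforward mu phi)))//.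
move=> X [[u v]] _ <-.
change (mu `]u, v]%classic =
  (`|a|%:E * mu ((fun x => a * x + b)%R @^-1` `]u, v]%classic))%E).
have [a_gt0|a_le0] := ltP 0 a.
  rewrite (_ : _ @^-1` _ = `](u - b) / a, (v - b) / a]%classic); last first.
    apply/seteqP; split => x /=; rewrite !in_itv/= ltr_pdivrMr// ler_pdivlMr// [x * a]mulrC;
    by rewrite ltrBlDr lerBrDr.
  rewrite !lebesgue_measure_itv/= !lte_fin ltr_pM2r ?invr_gt0// ltrD2r.
  case: ifPn => uv; last by rewrite mule0.
  rewrite -!EFinB -EFinM; congr EFin; rewrite gtr0_norm//; field.
  by rewrite gt_eqF.
have {a0 a_le0}a_lt0 : a < 0 by rewrite lt_neqAle a0.
rewrite (_ : _ @^-1` _ = `[(v - b) / a, (u - b) / a[%classic); last first.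
  apply/seteqP; split => x /=; rewrite !in_itv/= ltr_ndivlMr// ler_ndivrMr// [x * a]mulrC;
  by rewrite ltrBlDr lerBrDr andbC.
rewrite !lebesgue_measure_itv/= !lte_fin ltr_nM2r ?invr_lt0// ltrD2r.
case: ifPn => uv; last by rewrite mule0.
rewrite -!EFinB -EFinM; congr EFin; rewrite ltr0_norm//; field.
by rewrite lt_eqF.
Qed.

Lemma ge0_int_affine (a b : R) (f : R -> \bar R) : a != 0 ->
  measurable_fun setT f -> (forall x, 0 <= f x)%E ->
  (\int[mu]_x f x = `|a|%:E * \int[mu]_x f (a * x + b)%R)%E.
Proof.
move=> a0 mf f0.
pose phi : {mfun measurableTypeR R >-> measurableTypeR R} :=
  HB.pack (fun x : measurableTypeR R => (a * x + b)%R : measurableTypeR R)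
   (isMeasurableFun.Build _ _ _ _ _ (affine_measT a b)).
pose a' : {nonneg R} := NngNum (normr_ge0 a).
rewrite (eq_measure_integral (mscale a' (pushforward mu phi))); last first.
  by move=> A mA _; exact: (lebesgue_affine b a0 mA).
rewrite ge0_integral_mscale//.
by rewrite ge0_integral_pushforward// preimage_setT.
Qed.

Lemma rint_affine (a b : R) f : a != 0 -> meas f ->
  rint f = `|a| * rint (fun x => f (a * x + b)).
Proof.
move=> a0 mf; rewrite /rint /Rintegral [in LHS]integralE [in RHS]integralE.
have mF : measurable_fun setT (EFin \o f) by exact/measurable_EFinP.
rewrite (ge0_int_affine b a0)//; last exact: measurable_funepos.
rewrite [X in (_ - X)%E](ge0_int_affine b a0)//; last exact: measurable_funeneg.
set I := (\int[_]_(_ in _) _)%E; set J := (\int[_]_(_ in _) _)%E.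
set I' := (\int[_]_(_ in _) _)%E; set J' := (\int[_]_(_ in _) _)%E.
have -> : I' = I by apply: eq_integral => x _; rewrite !unlock.
have -> : J' = J by apply: eq_integral => x _; rewrite !unlock.
have I0 : (0 <= I)%E by exact: integral_ge0.
have J0 : (0 <= J)%E by exact: integral_ge0.
have aE : (0 < `|a|) by rewrite normr_gt0.
(* If a part is infinite it stays infinite after multiplication by [|a| > 0], and [fine] then
   returns the same default 0 on both sides. *)
clearbody I J; clear I' J'; case: I I0 => [i| |]//; case: J J0 => [j| |]//= _ _;
 rewrite ?(gt0_muley) ?lte_fin//= ?mulr0//.
by rewrite mulrBr.
Qed.

Lemma integ_affine (a b : R) f : a != 0 -> integ f ->
  integ (fun x => f (a * x + b)).
Proof.
move=> a0 /integrableP[mf fi]; apply/integrableP; split.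
  apply/measurable_EFinP; apply: (measurableT_comp (f := f)) (affine_meas a b).
  exact/measurable_EFinP.
move: fi; rewrite (ge0_int_affine b a0)//; last exact: measurableT_comp.
set I := (\int[_]_(_ in _) _)%E => fi; change (I < +oo)%E; move: fi.
have I0 : (0 <= I)%E by exact: integral_ge0.
clearbody I; case: I I0 => [i| |]//= _; first by move=> _; rewrite ltry.
by rewrite gt0_muley ?lte_fin ?normr_gt0.
Qed.

Lemma meas_EFin f : meas f -> measurable_fun setT (fun x => (f x)%:E).
Proof. by move=> ?; exact/measurable_EFinP. Qed.

Lemma integ_meas f : integ f -> meas f.
Proof. by move=> /integrableP[/measurable_EFinP]. Qed.

Lemma integ_le f g : meas f -> integ g -> (forall x, `|f x| <= g x) -> integ f.
Proof.
move=> mf ig fg; apply: (le_integrable _ _ _ ig) => //; first exact/measurable_EFinP.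
by move=> x _ /=; rewrite lee_fin (le_trans (fg x))// ler_norm.
Qed.

Lemma integ_ge0P f : meas f -> (forall x, 0 <= f x) ->
  integ f <-> (\int[mu]_x (f x)%:E < +oo)%E.
Proof.
move=> mf f0; rewrite /integ.
have e : (\int[mu]_x `|(EFin \o f) x| = \int[mu]_x (f x)%:E)%E.
  by apply: eq_integral => x _ /=; rewrite ger0_norm.
split; first by move=> /integrableP[_]; rewrite e.
by move=> fi; apply/integrableP; split; [exact/measurable_EFinP|rewrite e].
Qed.

Lemma rintE f : integ f -> (\int[mu]_x (f x)%:E)%E = (rint f)%:E.
Proof. by move=> fi; rewrite /rint /Rintegral fineK//; exact: integrable_fin_num. Qed.

Lemma rintZ (c : R) f : integ f -> rint (fun x => c * f x) = c * rint f.
Proof. by move=> fi; rewrite /rint RintegralZl. Qed.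

Lemma rintD f g : integ f -> integ g -> rint (fun x => f x + g x) = rint f + rint g.
Proof. by move=> fi gi; rewrite /rint RintegralD. Qed.

Lemma integZ (c : R) f : integ f -> integ (fun x => c * f x).
Proof. by move=> fi; have := integrableZl measurableT c fi. Qed.

Lemma integD f g : integ f -> integ g -> integ (fun x => f x + g x).
Proof. by move=> fi gi; have := integrableD measurableT fi gi. Qed.

Lemma integB f g : integ f -> integ g -> integ (fun x => f x - g x).
Proof. by move=> fi gi; have := integrableB measurableT fi gi. Qed.

Lemma rintB f g : integ f -> integ g -> rint (fun x => f x - g x) = rint f - rint g.
Proof. by move=> fi gi; rewrite /rint RintegralB. Qed.

Lemma le_rint f g : integ f -> integ g -> (forall x, f x <= g x) -> rint f <= rint g.
Proof. by move=> fi gi fg; apply: le_Rintegral. Qed.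

Lemma rint_norm f : integ f -> `|rint f| <= rint (fun x => `|f x|).
Proof. by move=> fi; exact: le_normr_Rintegral. Qed.

Lemma integ_norm f : integ f -> integ (fun x => `|f x|).
Proof. by move=> fi; exact: integrable_norm. Qed.

Lemma eq_rint f g : f =1 g -> rint f = rint g.
Proof. by move=> /funext ->. Qed.

Lemma rint_ge0 f : (forall x, 0 <= f x) -> 0 <= rint f.
Proof. by move=> f0; exact: Rintegral_ge0. Qed.

Lemma continuous_meas f : continuous f -> meas f.
Proof. exact: continuous_measurable_fun. Qed.

Lemma rint_dct (f_ : nat -> R -> R) f g : (forall n, meas (f_ n)) -> integ g ->
  (forall x, f_ ^~ x @ \oo --> f x) -> (forall n x, `|f_ n x| <= g x) ->
  (fun n => rint (f_ n)) @ \oo --> rint f.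
Proof.
move=> mf ig cf fg.
have mfl : meas f by exact: (measurable_fun_cvg mf (fun x _ => cf x)).
have fgl x : `|f x| <= g x.
  have h : (fun n => `|f_ n x|) @ \oo --> `|f x| by apply: cvg_norm; exact: cf.
  rewrite -(cvg_lim _ h)//; apply: limr_le; first by apply/cvg_ex; eexists; exact: h.
  by apply: nearW => n; exact: fg.
have ifl : integ f by exact: (integ_le mfl ig fgl).
apply: fine_cvg; rewrite -[X in _ --> X]/((rint f)%:E) -(rintE ifl); apply: (@dominated_cvg _ _ _ mu _ measurableT _ _ (EFin \o g)) => //.
- by move=> n; exact: (meas_EFin (mf n)).
- by move=> x _; apply: cvg_EFin; [exact: nearW|exact: cf].
- by move=> n x _ /=; rewrite lee_fin.
Qed.

Lemma oneDsqr_gt0 (x : R) : 0 < 1 + x ^+ 2.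
Proof. by rewrite ltr_pwDl// sqr_ge0. Qed.

Lemma continuous_inv1Dsqr : continuous (fun x : R => (1 + x ^+ 2)^-1).
Proof. exact: continuous_oneDsqrV. Qed.

Lemma int_inv1Dsqr : (\int[mu]_x ((1 + x ^+ 2)^-1)%:E = pi%:E)%E.
Proof.
pose f x : R := (1 + x ^+ 2)^-1.
have f0 x : 0 <= f x by rewrite invr_ge0 ltW// oneDsqr_gt0.
have := @ge0_symfun_integralT R f f0 continuous_inv1Dsqr.
move=> ->; last by move=> x; rewrite /f /= sqrrN.
have := @integral0y_oneDsqr R; rewrite /oneDsqr => h.
rewrite (_ : [set x | _] = `[0, +oo[%classic); last first.
  by apply/seteqP; split => x /=; rewrite in_itv/= andbT.
rewrite [X in (_ * X)%E]h -EFinM; congr EFin; lra.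
Qed.

Lemma integ_inv1Dsqr : integ (fun x : R => (1 + x ^+ 2)^-1).
Proof.
apply/integ_ge0P; first exact: continuous_meas continuous_inv1Dsqr.
  by move=> x; rewrite invr_ge0 ltW// oneDsqr_gt0.
by rewrite int_inv1Dsqr ltry.
Qed.

Lemma rint_inv1Dsqr : rint (fun x : R => (1 + x ^+ 2)^-1) = pi.
Proof. by rewrite /rint /Rintegral int_inv1Dsqr. Qed.

(** The standard majorant: decay estimates below are brought to the form [K / (1 + x ^+ 2)], and
    [K = 0] covers the zero function. *)
Lemma integ_dom (K : R) f : meas f -> (forall x, `|f x| <= K / (1 + x ^+ 2)) -> integ f.
Proof. by move=> mf fK; apply: (integ_le mf (integZ K integ_inv1Dsqr)). Qed.

Definition hasd (f : R -> R) (x df : R) : Prop := is_derive x (1 : R) f df.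

(** The compact fundamental theorem is applied on [[-n, n]]; dominated convergence with majorant
    [|f|] handles the truncated integrals. *)
Lemma rint_FTC (F f : R -> R) (l1 l2 : R) :
  (forall x : R, hasd F x (f x)) -> continuous f -> integ f ->
  F x @[x --> -oo] --> l1 -> F x @[x --> +oo] --> l2 -> rint f = l2 - l1.
Proof.
move=> dF cf fi F1 F2.
pose D n : set R := `[- n%:R, n%:R]%classic.
have measD n : measurable (D n) by exact: measurable_itv.
have h1 : (fun n => rint (fun x => f x * \1_(D n) x)) @ \oo --> rint f.
  apply: (rint_dct _ (integ_norm fi)).
  - move=> n; apply: measurable_funM; first exact: integ_meas.
    by apply: measurable_indic; exact: measD.
  - move=> x; apply: cvg_near_cst.
    exists (Num.truncn `|x|).+1 => // n /= xn.
    have xn' : `|x| <= n%:R.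
      by rewrite (le_trans (ltW (truncnS_gt _)))// ler_nat.
    rewrite indicE mem_set ?mulr1//= /D/= in_itv/= -ler_norml//.
  - move=> n x; rewrite normrM ler_piMr// indicE.
    by case: (_ \in _); rewrite ?normr1 ?normr0.
have h2 : (fun n => F n%:R - F (- n%:R)) @ \oo --> l2 - l1.
  apply: cvgB; first exact: (cvg_comp _ _ (@cvgr_idn R) F2).
  have F1' : F (- x) @[x --> +oo] --> l1.
    by apply: cvg_comp F1; rewrite ninfty.
  exact: (cvg_comp _ _ (@cvgr_idn R) F1').
apply/esym; apply: (cvg_unique _ h2); first exact: norm_hausdorff.
apply: cvg_trans h1; apply: near_eq_cvg; exists 1 => // n /= n0.
have n0' : - n%:R < n%:R :> R by have : 0 < n%:R :> R by [rewrite ltr0n]; lra.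
rewrite /rint.
under eq_Rintegral do rewrite mulrC -[_ * _]/((\1_(D n) * f) _).
transitivity (Rintegral mu (D n) f).
  rewrite [RHS]Rintegral_mkcond; apply: eq_Rintegral => x _.
  rewrite patchE -[LHS]/(\1_(D n) x * f x) indicE.
  by case: (x \in D n); rewrite ?mul1r ?mul0r.
rewrite /Rintegral (@continuous_FTC2 _ f F)//.
- by apply: continuous_subspaceT => x; exact: cf.
- have cF x : {for x, continuous F}.
    by apply/differentiable_continuous/derivable1_diffP; have [] := dF x.
  split.
  + by move=> x _; have [] := dF x.
  + by apply: cvg_at_right_filter; exact: cF.
  + by apply: cvg_at_left_filter; exact: cF.
- by move=> x _; rewrite derive1E; have [] := dF x.
Qed.

Lemma exprn_le_expR n (x : R) : 0 <= x -> x ^+ n <= n`!%:R * expR x.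
Proof.
case: n => [|n] x0; first by rewrite expr0 fact0 mul1r (le_trans _ (expR_ge1Dx x))// lerDl.
have := expR_ge1Dxn n x0; rewrite -ler_pdivrMl ?ltr0n ?fact_gt0// mulrC.
by apply: le_trans; rewrite lerDr.
Qed.
End RealLine.

(** * Measurability and complex-valued integrals *)

Section Measurability.
Context d (T : measurableType d) (R : realType).
Implicit Types f g : T -> R.
Local Notation C := R[i].

Lemma meas_cst (c : R) : measurable_fun [set: T] (fun=> c).
Proof. exact: measurable_cst. Qed.
Lemma measD f g : measurable_fun setT f -> measurable_fun setT g ->
  measurable_fun setT (fun x => f x + g x).
Proof. exact: measurable_funD. Qed.
Lemma measM f g : measurable_fun setT f -> measurable_fun setT g ->
  measurable_fun setT (fun x => f x * g x).
Proof. exact: measurable_funM. Qed.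
Lemma measN f : measurable_fun setT f -> measurable_fun setT (fun x => - f x).
Proof. exact: measurable_funN. Qed.
Lemma measX f n : measurable_fun setT f -> measurable_fun setT (fun x => f x ^+ n).
Proof. exact: measurable_funX. Qed.
Lemma meas_comp (h : R -> R) f : meas h -> measurable_fun setT f ->
  measurable_fun setT (fun x => h (f x)).
Proof. by move=> mh mf; exact: (measurableT_comp mh mf). Qed.
Lemma meas_exp f : measurable_fun setT f -> measurable_fun setT (fun x => expR (f x)).
Proof. by apply: meas_comp; exact: measurable_expR. Qed.
Lemma meas_ln f : measurable_fun setT f -> measurable_fun setT (fun x => ln (f x)).
Proof. by apply: meas_comp; exact: measurable_ln. Qed.
Lemma meas_cos f : measurable_fun setT f -> measurable_fun setT (fun x => cos (f x)).
Proof. by apply: meas_comp; apply: continuous_meas; exact: continuous_cos. Qed.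
Lemma meas_sin f : measurable_fun setT f -> measurable_fun setT (fun x => sin (f x)).
Proof. by apply: meas_comp; apply: continuous_meas; exact: continuous_sin. Qed.
Lemma meas_sqrt f : measurable_fun setT f -> measurable_fun setT (fun x => Num.sqrt (f x)).
Proof. by apply: meas_comp; apply: continuous_meas; exact: sqrt_continuous. Qed.
Lemma meas_norm f : measurable_fun setT f -> measurable_fun setT (fun x => `|f x|).
Proof. by apply: meas_comp; apply: continuous_meas; exact: norm_continuous. Qed.

Definition cmeas (f : T -> C) : Prop :=
  measurable_fun setT (fun x => complex.Re (f x)) /\
  measurable_fun setT (fun x => complex.Im (f x)).
End Measurability.

Lemma meas_fst (R : realType) : measurable_fun [set: R * R] (fun z : R * R => z.1).
Proof. exact: measurable_fst. Qed.
Lemma meas_snd (R : realType) : measurable_fun [set: R * R] (fun z : R * R => z.2).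
Proof. exact: measurable_snd. Qed.
Lemma meas_id (R : realType) : measurable_fun [set: R] (fun z : R => z).
Proof. exact: measurable_id. Qed.

Ltac mea := repeat first [ assumption | apply: meas_cst | apply: meas_id | apply: meas_fst | apply: meas_snd
  | apply: measD | apply: measN | apply: measX | apply: measM | apply: meas_exp | apply: meas_ln
  | apply: meas_cos | apply: meas_sin | apply: meas_norm | apply: meas_sqrt].

Section ComplexBasics.
Variable R : realType.
Local Notation C := R[i].
Local Notation Re := complex.Re.
Local Notation Im := complex.Im.
Implicit Types (z w s : C).
Local Open Scope complex_scope.

Lemma cext z w : Re z = Re w -> Im z = Im w -> z = w.
Proof. by case: z => a b; case: w => c d /= -> ->. Qed.
Lemma ReM z w : Re (z * w) = Re z * Re w - Im z * Im w.
Proof. by case: z; case: w. Qed.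
Lemma ImM z w : Im (z * w) = Re z * Im w + Im z * Re w.
Proof. by case: z; case: w. Qed.
Lemma ReD z w : Re (z + w) = Re z + Re w.
Proof. by case: z; case: w. Qed.
Lemma ImD z w : Im (z + w) = Im z + Im w.
Proof. by case: z; case: w. Qed.
Lemma ReN z : Re (- z) = - Re z.
Proof. by case: z. Qed.
Lemma ImN z : Im (- z) = - Im z.
Proof. by case: z. Qed.
Definition ReImE := (ReM, ImM, ReD, ImD, ReN, ImN).

Definition nrm z : R := Normc.normc z.
Lemma nrmE z : nrm z = Num.sqrt (Re z ^+ 2 + Im z ^+ 2).
Proof. by case: z. Qed.
Lemma nrm_ge0 z : 0 <= nrm z.
Proof. by rewrite nrmE sqrtr_ge0. Qed.
Lemma nrmM z w : nrm (z * w) = nrm z * nrm w.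
Proof. exact: Normc.normcM. Qed.
Lemma nrmR (x : R) : nrm x%:C = `|x|.
Proof. by rewrite nrmE/= expr0n/= addr0 sqrtr_sqr. Qed.
Lemma Re_nrm z : `|Re z| <= nrm z.
Proof. by rewrite nrmE -sqrtr_sqr ler_wsqrtr// lerDl sqr_ge0. Qed.
Lemma Im_nrm z : `|Im z| <= nrm z.
Proof. by rewrite nrmE -sqrtr_sqr ler_wsqrtr// lerDr sqr_ge0. Qed.
Lemma nrm_le z : nrm z <= `|Re z| + `|Im z|.
Proof.
rewrite nrmE -[leRHS]ger0_norm ?addr_ge0// -sqrtr_sqr ler_wsqrtr//.
rewrite sqrrD !real_normK ?num_real//.
by rewrite [leRHS]addrAC lerDl mulrn_wge0// mulr_ge0.
Qed.
Lemma nrm_eq0 z : nrm z = 0 -> z = 0.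
Proof. exact: Normc.eq0_normc. Qed.
Lemma nrm_gt0 z : z != 0 -> 0 < nrm z.
Proof. by move=> z0; rewrite lt0r nrm_ge0 andbT; apply: contra z0 => /eqP/nrm_eq0 ->. Qed.

(* [e^(s y)]; locked to keep unification from unfolding it into [cos] and [sin]. *)
Definition cexp : C -> R -> C := locked (fun s y =>
  (expR (Re s * y))%:C * (cos (Im s * y) +i* sin (Im s * y))).

Lemma Re_cexp s y : Re (cexp s y) = expR (Re s * y) * cos (Im s * y).
Proof. by rewrite /cexp -lock /= mul0r subr0. Qed.
Lemma Im_cexp s y : Im (cexp s y) = expR (Re s * y) * sin (Im s * y).
Proof. by rewrite /cexp -lock /= mul0r addr0. Qed.
Lemma cexpNr s y : cexp s (- y) = cexp (- s) y.
Proof. by rewrite /cexp -!lock !ReImE !mulrN !mulNr. Qed.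
Lemma cexpMr s (a y : R) : cexp s (a * y) = cexp (a%:C * s) y.
Proof.
by rewrite /cexp -!lock !ReImE/= !mul0r subr0 addr0; congr ((expR _)%:C * (cos _ +i* sin _)); ring.
Qed.
Lemma cpowE (x : R) s : cpow x s = cexp s (ln x).
Proof. by rewrite /cexp -lock. Qed.
Lemma cexpDl s w y : cexp (s + w) y = cexp s y * cexp w y.
Proof.
apply: cext; rewrite ?ReImE !(Re_cexp, Im_cexp) ?ReImE !mulrDl expRD ?cosD ?sinD; ring.
Qed.
Lemma cexpDr s x y : cexp s (x + y) = cexp s x * cexp s y.
Proof.
apply: cext; rewrite ?ReImE !(Re_cexp, Im_cexp) !mulrDr expRD ?cosD ?sinD; ring.
Qed.
Lemma cexp0 y : cexp 0 y = 1.
Proof. by apply: cext; rewrite (Re_cexp, Im_cexp)/= !mul0r expR0 (cos0, sin0) mul1r. Qed.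
Lemma cexp_real (x y : R) : cexp x%:C y = (expR (x * y))%:C.
Proof. by apply: cext; rewrite (Re_cexp, Im_cexp)/= !mul0r (cos0, sin0) (mulr1, mulr0). Qed.
Lemma cexpNM s y : cexp (- s) y * cexp s y = 1.
Proof. by rewrite -cexpDl addNr cexp0. Qed.
Lemma cexp_neq0 s y : cexp s y != 0.
Proof.
by apply/eqP => e; have := cexpNM s y; rewrite e mulr0 => /esym/eqP; rewrite oner_eq0.
Qed.
Lemma cexpN s y : cexp (- s) y = (cexp s y)^-1.
Proof. by apply: (mulIf (cexp_neq0 s y)); rewrite cexpNM mulVf// cexp_neq0. Qed.
Lemma nrm_cexp s y : nrm (cexp s y) = expR (Re s * y).
Proof.
rewrite nrmE Re_cexp Im_cexp !exprMn -mulrDr cos2Dsin2 mulr1 sqrtr_sqr ger0_norm//.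
Qed.
End ComplexBasics.

Section ComplexMeasurable.
Context d (T : measurableType d) (R : realType).
Local Notation C := R[i].
Implicit Types f g : T -> C.

Lemma cmeasM f g : cmeas f -> cmeas g -> cmeas (fun x => f x * g x).
Proof.
move=> [f1 f2] [g1 g2]; split.
- by under eq_fun do rewrite ReM; mea.
- by under eq_fun do rewrite ImM; mea.
Qed.
Lemma cmeasD f g : cmeas f -> cmeas g -> cmeas (fun x => f x + g x).
Proof.
move=> [f1 f2] [g1 g2]; split.
- by under eq_fun do rewrite ReD; mea.
- by under eq_fun do rewrite ImD; mea.
Qed.
Lemma cmeasN f : cmeas f -> cmeas (fun x => - f x).
Proof.
move=> [f1 f2]; split.
- by under eq_fun do rewrite ReN; mea.
- by under eq_fun do rewrite ImN; mea.
Qed.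
Lemma cmeas_cst (c : C) : cmeas (fun _ : T => c).
Proof. by split; mea. Qed.
Lemma cmeasC (f g : T -> R) : measurable_fun setT f -> measurable_fun setT g ->
  cmeas (fun x => (f x +i* g x)%C).
Proof. by split. Qed.
Lemma cmeasR (f : T -> R) : measurable_fun setT f -> cmeas (fun x => (f x)%:C%C).
Proof. by move=> mf; split => //=; mea. Qed.
Lemma cmeas_cexp f (g : T -> R) : cmeas f -> measurable_fun setT g -> cmeas (fun x => cexp (f x) (g x)).
Proof.
move=> [f1 f2] mg; split.
- by under eq_fun do rewrite Re_cexp; mea.
- by under eq_fun do rewrite Im_cexp; mea.
Qed.
Lemma meas_nrm f : cmeas f -> measurable_fun setT (fun x => nrm (f x)).
Proof. by move=> [f1 f2]; under eq_fun do rewrite nrmE; mea. Qed.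
End ComplexMeasurable.

Ltac cmea := repeat first [ assumption | apply: cmeas_cst | apply: cmeasR | apply: cmeasM | apply: cmeasD
  | apply: cmeasN | apply: cmeas_cexp | apply: cmeasC | progress mea].

Section Fubini.
Variable R : realType.
Notation mu := (@lebesgue_measure R).

Lemma tonelli (f : R -> R -> \bar R) :
  measurable_fun setT (fun z : R * R => f z.1 z.2) -> (forall x y, 0 <= f x y)%E ->
  (\int[mu]_x \int[mu]_y f x y = \int[mu]_y \int[mu]_x f x y)%E.
Proof.
move=> mf f0.
by have := @fubini_tonelli _ _ _ _ R mu mu (fun z => f z.1 z.2) mf (fun z => f0 z.1 z.2).
Qed.

Lemma meas_section (f : R -> R -> R) :
  measurable_fun setT (fun z : R * R => f z.1 z.2) -> forall x, meas (f x).
Proof.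
move=> mf x; apply: (measurableT_comp (g := fun y => (x, y)) mf).
by apply: measurable_fun_pair; [exact: meas_cst|exact: meas_id].
Qed.

Lemma le_iint (f g : R -> R -> R) :
  measurable_fun setT (fun z : R * R => f z.1 z.2) ->
  measurable_fun setT (fun z : R * R => g z.1 z.2) ->
  (forall x y, 0 <= f x y) -> (forall x y, f x y <= g x y) ->
  (\int[mu]_x \int[mu]_y (f x y)%:E <= \int[mu]_x \int[mu]_y (g x y)%:E)%E.
Proof.
move=> mf mg f0 fg; have g0 x y : 0 <= g x y by exact: le_trans (f0 x y) (fg x y).
have mf' : measurable_fun [set: measurableTypeR R * measurableTypeR R]
    (fun z : R * R => (f z.1 z.2)%:E) by apply/measurable_EFinP.
have mg' : measurable_fun [set: measurableTypeR R * measurableTypeR R]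
    (fun z : R * R => (g z.1 z.2)%:E) by apply/measurable_EFinP.
apply: ge0_le_integral => //.
- by move=> x _; apply: integral_ge0 => y _; rewrite lee_fin.
- exact: (@measurable_fun_fubini_tonelli_F _ _ _ _ R mu _ mf' (fun z => f0 _ _)).
- exact: (@measurable_fun_fubini_tonelli_F _ _ _ _ R mu _ mg' (fun z => g0 _ _)).
move=> x _; apply: ge0_le_integral => //.
- by move=> y _; rewrite lee_fin.
- exact: (meas_EFin (meas_section mf x)).
- exact: (meas_EFin (meas_section mg x)).
- by move=> y _; rewrite lee_fin.
Qed.

(** The inner integral is finite only for almost every [x], so [fine] can be removed only almost
    everywhere, which the outer integral does not see. *)
Lemma rint_fubini_half (m1 m2 : {sigma_finite_measure set (measurableTypeR R) -> \bar R})
  (f : R * R -> \bar R) : (m1 \x m2)%E.-integrable setT f ->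
  (\int[m1]_x (fine (\int[m2]_y f (x, y)))%:E = \int[m1]_x \int[m2]_y f (x, y))%E.
Proof.
move=> fi; have mF := measurable_fubini_F fi.
apply: ae_eq_integral => //.
  by apply/measurable_EFinP; apply: measurableT_comp mF; exact: fine_measurable.
have := ae_integrable1 fi; apply: filterS => x fx _.
by rewrite fineK//; exact: integrable_fin_num.
Qed.

Lemma rint_fubini (f : R -> R -> R) :
  measurable_fun setT (fun z : R * R => f z.1 z.2) ->
  (\int[mu]_x \int[mu]_y `|f x y|%:E < +oo)%E ->
  rint (fun x => rint (f x)) = rint (fun y => rint (f^~ y)).
Proof.
move=> mf fi.
have mF : measurable_fun [set: measurableTypeR R * measurableTypeR R]
  (fun z : R * R => (f z.1 z.2)%:E) by exact/measurable_EFinP.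
have i1 : (mu \x mu)%E.-integrable setT (fun z : R * R => (f z.1 z.2)%:E).
  by apply/(@integrable12ltyP _ _ _ _ R mu mu _ mF).
have mG : measurable_fun [set: measurableTypeR R * measurableTypeR R] (fun z : R * R => (f z.2 z.1)%:E).
  apply/measurable_EFinP; apply: (measurableT_comp (f := fun z : R * R => f z.1 z.2) (g := fun z => (z.2, z.1))) => //.
  by apply: measurable_fun_pair; [exact: meas_snd|exact: meas_fst].
have i2 : (mu \x mu)%E.-integrable setT (fun z : R * R => (f z.2 z.1)%:E).
  by apply/(@integrable21ltyP _ _ _ _ R mu mu _ mG).
have h1 := rint_fubini_half i1; have h2 := rint_fubini_half i2.
rewrite /rint /Rintegral/=; congr fine.
rewrite h1 h2; exact: (Fubini i1).
Qed.
End Fubini.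

Section ComplexIntegral.
Variable R : realType.
Notation mu := (@lebesgue_measure R).
Local Notation C := R[i].
Local Notation Re := complex.Re.
Local Notation Im := complex.Im.
Implicit Types (f g : R -> C) (h : R -> R).
Local Open Scope complex_scope.

Definition cinteg f : Prop := integ (fun x => Re (f x)) /\ integ (fun x => Im (f x)).

Lemma cRintE f : cRint f = rint (fun x => Re (f x)) +i* rint (fun x => Im (f x)).
Proof. by []. Qed.
Lemma eq_cRint f g : f =1 g -> cRint f = cRint g.
Proof. by move=> /funext ->. Qed.
Lemma cinteg_le f h : cmeas f -> integ h -> (forall x, nrm (f x) <= h x) -> cinteg f.
Proof.
move=> [m1 m2] ih fh; split; apply: (integ_le _ ih) => // x.
- exact: le_trans (Re_nrm _) (fh x).
- exact: le_trans (Im_nrm _) (fh x).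
Qed.
Lemma cinteg_cmeas f : cinteg f -> cmeas f.
Proof. by move=> [/integ_meas ? /integ_meas ?]; split. Qed.
Lemma integ_nrm f : cinteg f -> integ (fun x => nrm (f x)).
Proof.
move=> fi; have [f1 f2] := fi.
apply: (integ_le _ (integD (integ_norm f1) (integ_norm f2))).
  exact/meas_nrm/cinteg_cmeas.
by move=> x; rewrite ger0_norm ?nrm_ge0// nrm_le.
Qed.
Lemma cintegZ (c : C) f : cinteg f -> cinteg (fun x => c * f x).
Proof.
move=> [f1 f2]; split.
- under eq_fun do rewrite ReM; exact: (integB (integZ _ f1) (integZ _ f2)).
- under eq_fun do rewrite ImM; exact: (integD (integZ _ f2) (integZ _ f1)).
Qed.
Lemma cRintZ (c : C) f : cinteg f -> cRint (fun x => c * f x) = c * cRint f.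
Proof.
move=> [f1 f2]; apply: cext; rewrite ?ReImE !cRintE/=.
- under eq_rint do rewrite ReM.
  by rewrite rintB ?rintZ//; exact: integZ.
- under eq_rint do rewrite ImM.
  by rewrite rintD ?rintZ//; exact: integZ.
Qed.
Lemma cRintD f g : cinteg f -> cinteg g -> cRint (fun x => f x + g x) = cRint f + cRint g.
Proof.
move=> [f1 f2] [g1 g2]; apply: cext; rewrite ?ReImE !cRintE/=.
- by under eq_rint do rewrite ReD; rewrite rintD.
- by under eq_rint do rewrite ImD; rewrite rintD.
Qed.
Lemma cRint_affine (a b : R) f : a != 0 -> cmeas f ->
  cRint f = `|a|%:C * cRint (fun x => f (a * x + b)).
Proof.
move=> a0 [m1 m2]; apply: cext; rewrite ?ReImE !cRintE/= !mul0r ?subr0 ?addr0.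
- exact: (rint_affine b a0 m1).
- exact: (rint_affine b a0 m2).
Qed.
Lemma cRint_shift (b : R) f : cmeas f -> cRint (fun x => f (x + b)) = cRint f.
Proof.
move=> mf; rewrite (cRint_affine b (oner_neq0 R) mf) normr1 mul1r.
by apply: eq_cRint => x; rewrite mul1r.
Qed.
Lemma cRint_real h : cRint (fun x => (h x)%:C) = (rint h)%:C.
Proof. by apply: cext; rewrite cRintE//=; rewrite /rint /Rintegral integral0. Qed.
(** The factor 2 comes from bounding real and imaginary parts separately. The bound serves only to
    get finiteness, positivity and limits, for which the constant is immaterial. *)
Lemma nrm_cRint f : cinteg f -> nrm (cRint f) <= 2 * rint (fun x => nrm (f x)).
Proof.
move=> fi; have [f1 f2] := fi; have fn := integ_nrm fi.
apply: (le_trans (nrm_le _)); rewrite mulr_natl mulr2n cRintE/=; apply: lerD.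
- apply: (le_trans (rint_norm f1)); apply: (le_rint (integ_norm f1) fn) => x.
  exact: Re_nrm.
- apply: (le_trans (rint_norm f2)); apply: (le_rint (integ_norm f2) fn) => x.
  exact: Im_nrm.
Qed.
Lemma cfubini (f : R -> R -> C) : cmeas (fun z : R * R => f z.1 z.2) ->
  (\int[mu]_x \int[mu]_y (nrm (f x y))%:E < +oo)%E ->
  cRint (fun x => cRint (f x)) = cRint (fun y => cRint (f^~ y)).
Proof.
move=> mf fi; have [m1 m2] := mf; have mn := meas_nrm mf.
have key (g : R -> R -> R) : measurable_fun setT (fun z : R * R => g z.1 z.2) ->
    (forall x y, `|g x y| <= nrm (f x y)) ->
    (\int[mu]_x \int[mu]_y `|g x y|%:E < +oo)%E.
  move=> mg gf; apply: le_lt_trans fi; apply: le_iint => //; first by mea.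
apply: cext; rewrite !cRintE/=.
- exact: (rint_fubini m1 (key _ m1 (fun x y => Re_nrm _))).
- exact: (rint_fubini m2 (key _ m2 (fun x y => Im_nrm _))).
Qed.
End ComplexIntegral.

(** * Derivatives and decay at infinity *)

Section Derivatives.
Variable R : realType.
Implicit Types f g : R -> R.

Lemma hasdM f g (x df dg : R) : hasd f x df -> hasd g x dg ->
  hasd (fun y => f y * g y) x (f x * dg + g x * df).
Proof. by move=> hf hg; exact: (is_deriveM hf hg). Qed.
Lemma hasdD f g (x df dg : R) : hasd f x df -> hasd g x dg ->
  hasd (fun y => f y + g y) x (df + dg).
Proof. by move=> hf hg; exact: (is_deriveD hf hg). Qed.
Lemma hasdN f (x df : R) : hasd f x df ->
  hasd (fun y => - f y) x (- df).
Proof. by move=> hf; exact: (is_deriveN hf). Qed.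
Lemma hasd_cst (x c : R) : hasd (fun _ : R => c) x 0.
Proof. exact: is_derive_cst. Qed.
Lemma hasd_id (x : R) : hasd (fun y : R => y) x 1.
Proof. exact: is_derive_id. Qed.
Lemma hasd_exp f (x df : R) : hasd f x df ->
  hasd (fun y => expR (f y)) x (expR (f x) * df).
Proof. by move=> hf; apply: (is_derive1_comp (is_derive_expR (f x)) hf). Qed.
Lemma hasd_cos f (x df : R) : hasd f x df ->
  hasd (fun y => cos (f y)) x (- sin (f x) * df).
Proof. by move=> hf; apply: (is_derive1_comp (is_derive_cos (f x)) hf). Qed.
Lemma hasd_sin f (x df : R) : hasd f x df ->
  hasd (fun y => sin (f y)) x (cos (f x) * df).
Proof. by move=> hf; apply: (is_derive1_comp (is_derive_sin (f x)) hf). Qed.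

Lemma hasd_eq f (x df df' : R) : hasd f x df -> df = df' -> hasd f x df'.
Proof. by move=> h <-. Qed.

Lemma hasd_continuous f (df : R -> R) : (forall x : R, hasd f x (df x)) -> continuous f.
Proof. by move=> h x; apply/differentiable_continuous/derivable1_diffP; have [] := h x. Qed.

(** With [u = c |y|], the two summands of the constant come from [1 <= e^u] and [u^2 <= 2 e^u]. *)
Lemma exp_decay (c y : R) : 0 < c -> expR (- (c * `|y|)) <= (1 + 2 / c ^+ 2) / (1 + y ^+ 2).
Proof.
move=> c0; rewrite expRN ler_pdivlMr ?oneDsqr_gt0// mulrC ler_pdivrMr ?expR_gt0//.
have u0 : 0 <= c * `|y| by rewrite mulr_ge0// ltW.
have h1 : 1 <= expR (c * `|y|) by rewrite -expR0 ler_expR.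
have h2 := exprn_le_expR 2 u0.
rewrite mulrDl mul1r lerD// mulrAC ler_pdivlMr ?exprn_gt0//.
by move: h2; rewrite exprMn real_normK ?num_real// mulrC.
Qed.

Lemma dom_cvg0 f (K : R) : (forall x, `|f x| <= K / (1 + x ^+ 2)) ->
  f x @[x --> -oo] --> 0 /\ f x @[x --> +oo] --> 0.
Proof.
move=> fK.
have K0 : 0 <= K.
  by have := le_trans (normr_ge0 _) (fK 0); rewrite expr0n/= addr0 divr1.
have key e x : 0 < e -> 1 <= `|x| -> K / e < `|x| -> `|f x| < e.
  move=> e0 x1 xK; apply: le_lt_trans (fK x) _.
  rewrite ltr_pdivrMr ?oneDsqr_gt0//; move: xK; rewrite ltr_pdivrMr// => xK.
  apply: lt_le_trans xK _; rewrite mulrC ler_wpM2l// ?ltW//.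
  have : `|x| <= x ^+ 2 by rewrite -[x ^+ 2]real_normK ?num_real// expr2 ler_peMr.
  by move=> h; rewrite (le_lt_trans h)// ltrDr.
split; apply/cvgr0Pnorm_lt => e e0; near=> x; apply: key => //.
- rewrite ler0_norm; first by rewrite lerNr; near: x; apply: nbhs_ninfty_le; exact: num_real.
  by near: x; apply: nbhs_ninfty_le; exact: num_real.
- rewrite ltr0_norm; first by rewrite ltrNr; near: x; apply: nbhs_ninfty_lt; exact: num_real.
  by near: x; apply: nbhs_ninfty_lt; exact: num_real.
- rewrite ger0_norm; first by near: x; apply: nbhs_pinfty_ge; exact: num_real.
  by near: x; apply: nbhs_pinfty_ge; exact: num_real.
- rewrite ger0_norm; first by near: x; apply: nbhs_pinfty_gt; exact: num_real.
  by near: x; apply: nbhs_pinfty_ge; exact: num_real.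
Unshelve. all: by end_near. Qed.
End Derivatives.

Ltac ders := repeat first [ apply: hasd_cst | apply: hasd_id | apply: hasd_exp | apply: hasd_cos | apply: hasd_sin
   | apply: hasdN | apply: hasdM | apply: hasdD ].

(** * Euler's integral and Gauss's product *)

Section GammaIntegral.
Variable R : realType.
Local Notation C := R[i].
Local Notation Re := complex.Re.
Local Notation Im := complex.Im.
Implicit Types (z w s : C).
Local Open Scope complex_scope.

(* Euler's integral in the variable [y = ln t]. *)
Definition expNexp (y : R) : R := expR (- expR y).
Definition eGamma_kernel s (y : R) : C := cexp s y * (expNexp y)%:C.
Definition eGamma s : C := cRint (eGamma_kernel s).

Lemma expNexp_gt0 y : 0 < expNexp y. Proof. exact: expR_gt0. Qed.
Lemma expNexp_le1 y : expNexp y <= 1.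
Proof. by rewrite -expR0 ler_expR oppr_le0 expR_ge0. Qed.
Lemma meas_expNexp : meas expNexp.
Proof. by rewrite /meas/expNexp; mea. Qed.

(** For [y <= 0] the factor [e^(a y)] decays by itself. For [y > 0], with [t = e^y] and an integer
    [n >= a + 1], the inequality [t^n <= n! e^t] leaves [n! e^(-y)]. The constant is the sum of
    those of the two cases. *)
Lemma expNexp_bound (a : R) : 0 < a ->
  exists K, 0 < K /\ forall y, expR (a * y) * expNexp y <= K / (1 + y ^+ 2).
Proof.
move=> a0; pose n := (Num.truncn a).+2.
have an : a + 1 <= n%:R by rewrite -[n]addn1 natrD lerD2r ltW// truncnS_gt.
exists ((1 + 2 / a ^+ 2) + n`!%:R * (1 + 2 / 1 ^+ 2)); split.
  by rewrite addr_gt0 ?mulr_gt0 ?addr_gt0// ?ltr0n ?fact_gt0// divr_gt0// exprn_gt0.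
move=> y; have [y0|y0] := leP y 0.
  apply: (@le_trans _ _ (expR (- (a * `|y|)))).
    by rewrite ler0_norm// mulrN opprK ler_piMr ?expR_ge0// expNexp_le1.
  apply: (le_trans (exp_decay y a0)); rewrite ler_pM2r ?invr_gt0 ?oneDsqr_gt0// lerDl.
  by rewrite mulr_ge0// ?addr_ge0// ?divr_ge0// sqr_ge0.
apply: (@le_trans _ _ (n`!%:R * expR (- (1 * `|y|)))).
  rewrite gtr0_norm// /expNexp mul1r !expRN ler_pdivrMr ?expR_gt0// mulrAC ler_pdivlMr ?expR_gt0//.
  have := @exprn_le_expR R n (expR y) (expR_ge0 y).
  apply: le_trans; rewrite -expRM_natl -expRD ler_expR -[X in _ + X]mul1r -mulrDl.
  by rewrite ler_pM2r.
rewrite -ler_pdivlMl ?ltr0n ?fact_gt0//.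
apply: (le_trans (exp_decay y (ltr01 : 0 < 1 :> R))).
rewrite mulrA ler_pM2r ?invr_gt0 ?oneDsqr_gt0// mulrDr mulrA mulVf; last first.
  by rewrite pnatr_eq0 -lt0n fact_gt0.
rewrite mul1r lerDr mulr_ge0// ?invr_ge0//.
by rewrite addr_ge0 ?divr_ge0// sqr_ge0.
Qed.

Lemma cmeas_eGamma_kernel s : cmeas (eGamma_kernel s).
Proof. by apply: cmeasM; [apply: cmeas_cexp; [exact: cmeas_cst|exact: meas_id]|apply: cmeasR; exact: meas_expNexp]. Qed.

Lemma nrm_eGamma_kernel s y : nrm (eGamma_kernel s y) = expR (Re s * y) * expNexp y.
Proof. by rewrite nrmM nrm_cexp nrmR ger0_norm// ltW// expNexp_gt0. Qed.

Lemma cinteg_eGamma_kernel s : 0 < Re s -> cinteg (eGamma_kernel s).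
Proof.
move=> s0; have [K [K0 hK]] := expNexp_bound s0.
apply: (cinteg_le (cmeas_eGamma_kernel s) (integZ K (@integ_inv1Dsqr R))) => y.
by rewrite nrm_eGamma_kernel; exact: hK.
Qed.

Lemma cexp1 (y : R) : cexp 1 y = (expR y)%:C.
Proof. by rewrite -[1 in LHS]/((1 : R)%:C) cexp_real mul1r. Qed.

Lemma derive_eGamma_kernel s (y : R) :
  hasd (fun y => Re (eGamma_kernel s y)) y (Re (s * eGamma_kernel s y - eGamma_kernel (s + 1) y)) /\
  hasd (fun y => Im (eGamma_kernel s y)) y (Im (s * eGamma_kernel s y - eGamma_kernel (s + 1) y)).
Proof.
have dRe : hasd (fun y => Re (cexp s y)) y (Re (s * cexp s y)).
  under eq_fun do rewrite Re_cexp.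
  by apply: hasd_eq; [ders | rewrite ReM Re_cexp Im_cexp /=; ring].
have dIm : hasd (fun y => Im (cexp s y)) y (Im (s * cexp s y)).
  under eq_fun do rewrite Im_cexp.
  by apply: hasd_eq; [ders | rewrite ImM Re_cexp Im_cexp /=; ring].
have dex : hasd expNexp y (- (expR y * expNexp y)).
  by rewrite /expNexp; apply: hasd_eq; [ders | rewrite /=; ring].
split.
- under eq_fun do rewrite ReM /= mulr0 subr0.
  apply: hasd_eq; first exact: (hasdM dRe dex).
  rewrite /eGamma_kernel cexpDl cexp1 (mulrC (cexp s y)) !(mulrA s) ReD ReN !(ReM, ImM)/=; ring.
- under eq_fun do rewrite ImM /= mulr0 add0r.
  apply: hasd_eq; first exact: (hasdM dIm dex).
  rewrite /eGamma_kernel cexpDl cexp1 (mulrC (cexp s y)) !(mulrA s) ImD ImN !(ReM, ImM)/=; ring.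
Qed.

Lemma continuous_eGamma_kernel s : continuous (fun y => Re (eGamma_kernel s y)) /\ continuous (fun y => Im (eGamma_kernel s y)).
Proof.
by split; apply: hasd_continuous => y; have [h1 h2] := derive_eGamma_kernel s y; [exact: h1|exact: h2].
Qed.

(** Integration by parts: [s * eGamma_kernel s - eGamma_kernel (s + 1)] is the derivative of
    [eGamma_kernel s], which vanishes at both ends of the line. *)
Lemma eGammaD1 s : 0 < Re s -> eGamma (s + 1) = s * eGamma s.
Proof.
move=> s0; have s1 : 0 < Re (s + 1) by rewrite ReD/= ltr_pwDl.
have i0 := cinteg_eGamma_kernel s0; have i1 := cinteg_eGamma_kernel s1.
have i2 := cintegZ s i0; have i3 := cintegZ (-1) i1.
have [K [K0 hK0]] := expNexp_bound s0.
have hK y : nrm (eGamma_kernel s y) <= K / (1 + y ^+ 2) by rewrite nrm_eGamma_kernel; exact: hK0.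
suff h : cRint (fun y => s * eGamma_kernel s y + -1 * eGamma_kernel (s + 1) y) = 0.
  apply/esym/eqP; rewrite -subr_eq0 -h cRintD// !cRintZ//.
  by rewrite mulN1r.
under eq_cRint do rewrite mulN1r.
have [cR0 cI0] := continuous_eGamma_kernel s; have [cR1 cI1] := continuous_eGamma_kernel (s + 1).
have id : cinteg (fun y => s * eGamma_kernel s y - eGamma_kernel (s + 1) y).
  under eq_fun do rewrite -mulN1r.
  have [a1 a2] := i2; have [b1 b2] := i3.
  split; [under eq_fun do rewrite ReD|under eq_fun do rewrite ImD]; exact: integD.
have [id1 id2] := id.
apply: cext; rewrite cRintE/=.
- have [l1 l2] := @dom_cvg0 R (fun y => Re (eGamma_kernel s y)) K (fun y => le_trans (Re_nrm _) (hK y)).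
  rewrite (@rint_FTC R (fun y => Re (eGamma_kernel s y)) _ 0 0)// ?subr0//.
    by move=> y; have [] := derive_eGamma_kernel s y.
  move=> y; under eq_fun do rewrite ReD ReN ReM.
  by apply: cvgB; [apply: cvgB; (apply: cvgM; first exact: cvg_cst); [exact: cR0|exact: cI0]|exact: cR1].
- have [l1 l2] := @dom_cvg0 R (fun y => Im (eGamma_kernel s y)) K (fun y => le_trans (Im_nrm _) (hK y)).
  rewrite (@rint_FTC R (fun y => Im (eGamma_kernel s y)) _ 0 0)// ?subr0//.
    by move=> y; have [] := derive_eGamma_kernel s y.
  move=> y; under eq_fun do rewrite ImD ImN ImM.
  by apply: cvgB; [apply: cvgD; (apply: cvgM; first exact: cvg_cst); [exact: cI0|exact: cR0]|exact: cI1].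
Qed.

Lemma eGamma_real (x : R) : eGamma x%:C = (rint (fun y => expR (x * y) * expNexp y))%:C.
Proof.
rewrite /eGamma -cRint_real; apply: eq_cRint => y.
by rewrite /eGamma_kernel cexp_real -rmorphM.
Qed.

Lemma eGamma1 : eGamma 1 = 1.
Proof.
rewrite -[1 in LHS]/((1 : R)%:C) eGamma_real.
have -> : rint (fun y => expR (1 * y) * expNexp y) = 1; last by [].
have i1 : integ (fun y => expR (1 * y) * expNexp y).
  have [K [K0 hK]] := @expNexp_bound 1 ltr01.
  apply: (@integ_dom R K) => [|y]; first by rewrite /meas /expNexp; mea.
  by rewrite ger0_norm ?mulr_ge0 ?expR_ge0.
(* The primitive is normalised to vanish at minus infinity. *)
rewrite (@rint_FTC R (fun y => 1 - expNexp y) _ 0 1) ?subr0//.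
- by move=> y; rewrite /expNexp; apply: hasd_eq; [ders|rewrite /= mul1r; ring].
- apply: hasd_continuous => y; rewrite /expNexp; ders.
- apply/cvgr0Pnorm_lt => e e0; near=> y.
  rewrite ger0_norm ?subr_ge0 ?expNexp_le1//.
  apply: (@le_lt_trans _ _ (expR y)).
    by rewrite lerBlDl -lerBlDr; have := expR_ge1Dx (- expR y); rewrite /expNexp.
  rewrite -(@lnK _ e) ?posrE// ltr_expR.
  by near: y; apply: nbhs_ninfty_lt; exact: num_real.
- suff h : expNexp x @[x --> +oo] --> 0.
    by have := cvgB (cvg_cst (1 : R)) h; rewrite subr0; apply.
  apply/cvgr0Pnorm_lt => e e0; near=> y.
  rewrite ger0_norm ?expR_ge0// /expNexp -(@lnK _ e) ?posrE// ltr_expR ltrNl.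
  apply: (@lt_le_trans _ _ (1 + y)); last exact: expR_ge1Dx.
  by rewrite -ltrBlDl; near: y; apply: nbhs_pinfty_gt; exact: num_real.
Unshelve. all: by end_near. Qed.

Lemma Re_natD s m : 0 < Re s -> 0 < Re (s + (m%:R : R)%:C).
Proof. by move=> s0; rewrite ReD/= ltr_wpDr. Qed.

Lemma eGamma_prod s m : 0 < Re s ->
  \prod_(k < m) (s + (k%:R : R)%:C) * eGamma s = eGamma (s + (m%:R : R)%:C).
Proof.
move=> s0; elim: m => [|m IH]; first by rewrite big_ord0 mul1r addr0.
rewrite big_ord_recr/= mulrAC IH mulrC -eGammaD1 ?Re_natD//.
by rewrite -addrA; congr (eGamma (s + _)); rewrite -natr1 rmorphD.
Qed.

Lemma eGamma_fact n : eGamma (n.+1%:R : R)%:C = (n`!%:R : R)%:C.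
Proof.
elim: n => [|n IH]; first exact: eGamma1.
rewrite -natr1 rmorphD/= eGammaD1/= ?ltr0n// IH -rmorphM/=.
by rewrite factS natrM.
Qed.

Lemma rint_moment n : rint (fun y => expR (n.+1%:R * y) * expNexp y) = n`!%:R :> R.
Proof. by have := eGamma_fact n; rewrite eGamma_real => -[]. Qed.
End GammaIntegral.

(** * Gauss's product equals Euler's integral *)

Section GammaLimit.
Variable R : realType.
Local Notation C := R[i].
Local Notation Re := complex.Re.
Local Notation Im := complex.Im.
Implicit Types (z w s : C).
Local Open Scope complex_scope.

Lemma nrmD z w : nrm (z + w) <= nrm z + nrm w.
Proof. exact: le_normcD. Qed.
Lemma nrmN z : nrm (- z) = nrm z.
Proof. by rewrite !nrmE !ReImE !sqrrN. Qed.
Lemma nrm1 : nrm (1 : C) = 1.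
Proof. exact: Normc.normc1. Qed.

(* The majorant is [e] plus a polynomial in [expR l] vanishing to second order at [expR l = 1], so that only integer moments of the Gamma distribution are needed to integrate it. *)
Lemma cexp_near1 s (e : R) : 0 < Re s -> 0 < e ->
  exists K m, forall l : R, nrm (cexp s l - 1) <= e + K * ((2 + expR l ^+ m) * (expR l - 1) ^+ 2).
Proof.
move=> s0 e0; have e2 : 0 < e / 2 by rewrite divr_gt0.
have cR : continuous (fun l : R => expR (Re s * l) * cos (Im s * l)).
  by apply: hasd_continuous => y; ders.
have cI : continuous (fun l : R => expR (Re s * l) * sin (Im s * l)).
  by apply: hasd_continuous => y; ders.
have /cvgrPdist_lt/(_ _ e2) nR := cR 0.
have /cvgrPdist_lt/(_ _ e2) nI := cI 0.
have [eta /= eta0 H] : exists2 eta : R, 0 < eta & forall l, `|l| < eta -> nrm (cexp s l - 1) <= e.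
  have [eta /= eta0 H] := (nbhs_ballP (0 : R) _).1 (filterI nR nI).
  exists eta => // l le; have [] := H l _; first by rewrite /ball/= sub0r normrN.
  rewrite /= !mulr0 expR0 cos0 sin0 mulr1 mulr0 sub0r normrN => h1 h2.
  apply: (le_trans (nrm_le _)); rewrite !ReImE Re_cexp Im_cexp/= oppr0 addr0 distrC.
  by rewrite (splitr e) ltW// ltrD.
(* [c] bounds [|e^l - 1|] from below when [|l| >= eta]: for positive [l] because
   [e^l - 1 >= l >= eta >= c], for negative [l] by monotonicity. Dividing by [c ^+ 2] therefore
   makes the square at least 1 there, and [2 + e^(m l)] with [m > Re s] dominates
   [|e^(s l)| + 1]. *)
pose c : R := 1 - expR (- eta).
have c0 : 0 < c by rewrite subr_gt0 expR_lt1 oppr_lt0.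
exists ((c ^+ 2)^-1), (Num.truncn (Re s)).+1 => l.
set m := (Num.truncn _).+1.
have xm0 : 0 <= expR l ^+ m by rewrite exprn_ge0// expR_ge0.
have [/H h|le] := ltP `|l| eta.
  apply: (le_trans h); rewrite lerDl mulr_ge0 ?invr_ge0 ?sqr_ge0// mulr_ge0 ?sqr_ge0//.
apply: (@le_trans _ _ (2 + expR l ^+ m)).
  apply: (le_trans (nrmD _ _)); rewrite nrmN nrm1 nrm_cexp.
  have [l0|l0] := leP l 0.
    have : expR (Re s * l) <= 1 by rewrite expR_le1 pmulr_rle0.
    lra.
  have : expR (Re s * l) <= expR l ^+ m.
    by rewrite -expRM_natl ler_expR ler_pM2r// ltW// truncnS_gt.
  lra.
have h : c ^+ 2 <= (expR l - 1) ^+ 2.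
  rewrite -[leRHS]real_normK ?num_real// ler_sqr ?nnegrE ?(ltW c0)//.
  have [l0|l0] := leP 0 l.
    rewrite ger0_norm in le => //.
    rewrite ger0_norm ?subr_ge0; last by rewrite -expR0 ler_expR.
    have := expR_ge1Dx l; have := expR_ge1Dx (- eta); rewrite /c; lra.
  rewrite ltr0_norm in le => //.
  have : expR l <= expR (- eta) by rewrite ler_expR; lra.
  rewrite ler0_norm /c; [lra|rewrite subr_le0 -expR0 ler_expR; lra].
have : 2 + expR l ^+ m <= (c ^+ 2)^-1 * ((2 + expR l ^+ m) * (expR l - 1) ^+ 2).
  rewrite mulrCA -[leLHS]mulr1 ler_pM2l ?ltr_wpDr//.
  by rewrite mulrC ler_pdivlMr ?exprn_gt0// mul1r.
lra.
Qed.

(** The [k]-th moment of [X / (n + 1)] for [X] Gamma-distributed with parameter [n + 2]. *)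
Definition moment_ratio (n k : nat) : R := (n.+1 + k)`!%:R / (n.+1`!%:R * n.+1%:R ^+ k).

(** The quotient of the moments of orders [k + 1] and [k] is [1 + (k + 1) / (n + 1)], which tends to
    1. *)
Lemma cvg_moment_ratio k : moment_ratio ^~ k @ \oo --> (1 : R).
Proof.
elim: k => [|k IH].
  rewrite (_ : moment_ratio ^~ 0%N = fun=> 1); first exact: cvg_cst.
  by apply/funext => n; rewrite /moment_ratio addn0 expr0 mulr1 divff// pnatr_eq0 -lt0n fact_gt0.
rewrite (_ : moment_ratio ^~ k.+1 = fun n => moment_ratio n k * (1 + k.+1%:R * n.+1%:R^-1)).
  rewrite -[X in _ --> X](mulr1 1); apply: cvgM => //.
  rewrite -[X in _ --> X](addr0 1); apply: cvgD; first exact: cvg_cst.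
  rewrite -[X in _ --> X](mulr0 k.+1%:R); apply: cvgM; first exact: cvg_cst.
  exact: (@cvg_harmonic R).
apply/funext => n; rewrite /moment_ratio addnS factS -addnS natrM natrD exprS.
have n0 : (n.+1%:R : R) != 0 by rewrite pnatr_eq0.
have f0 : (n.+1`!%:R : R) != 0 by rewrite pnatr_eq0 -lt0n fact_gt0.
move: (n.+1%:R : R) (n.+1`!%:R : R) ((n.+1 + k)`!%:R : R) (k.+1%:R : R) n0 f0 => N F G K n0 f0.
by field; rewrite expf_neq0// f0 n0.
Qed.

(** Density of [ln X] for the Gamma variable [X] of parameter [n + 2]. Shifting [y] by [L n] passes
    to the logarithm of [X / (n + 1)], which concentrates at 0. *)
Let P n (y : R) : R := (n.+1`!%:R)^-1 * (expR (n.+2%:R * y) * expNexp y).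
Let L n : R := ln n.+1%:R.

Let P_ge0 n y : 0 <= P n y.
Proof. by rewrite mulr_ge0 ?invr_ge0// mulr_ge0 ?expR_ge0. Qed.

Lemma integ_expM_expNexp (a : R) : 0 < a -> integ (fun y => expR (a * y) * expNexp y).
Proof.
move=> a0; have [K [K0 hK]] := expNexp_bound a0.
apply: (@integ_dom R K) => [|y]; first by rewrite /meas /expNexp; mea.
by rewrite ger0_norm ?mulr_ge0 ?expR_ge0.
Qed.

Let momentE n k y : expR (y - L n) ^+ k * P n y =
  (n.+1`!%:R * n.+1%:R ^+ k)^-1 * (expR ((n.+1 + k).+1%:R * y) * expNexp y).
Proof.
rewrite /P /L expRD expRN lnK ?posrE ?ltr0n// exprMn -expRM_natl.
have -> : (n.+1 + k).+1%:R * y = n.+2%:R * y + k%:R * y by rewrite -addSn natrD mulrDl.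
rewrite [expR (_ + _)]expRD exprVn invfM.
move: (expR (n.+2%:R * y)) (expR (k%:R * y)) (n.+1`!%:R^-1 : R) ((n.+1%:R ^+ k)^-1 : R) => A B F N.
ring.
Qed.

Let moment n k : integ (fun y => expR (y - L n) ^+ k * P n y) /\
  rint (fun y => expR (y - L n) ^+ k * P n y) = moment_ratio n k.
Proof.
under eq_fun do rewrite momentE.
have i : integ (fun y : R => expR ((n.+1 + k).+1%:R * y) * expNexp y).
  by apply: integ_expM_expNexp; rewrite ltr0n.
by split; [exact: integZ|rewrite rintZ// rint_moment /moment_ratio mulrC].
Qed.

(** A polynomial in [expR (y - L n)], given by its pairs of coefficient and exponent, times the
    density [P n]. Since all moments tend to 1, its integral tends to the sum of the coefficients,
    the value of the polynomial at 1. *)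
Let lin n (cs : seq (R * nat)) y : R := \sum_(c <- cs) c.1 * (expR (y - L n) ^+ c.2 * P n y).

Let lin_int n cs : integ (lin n cs) /\ rint (lin n cs) = \sum_(c <- cs) c.1 * moment_ratio n c.2.
Proof.
rewrite /lin; elim: cs => [|c cs [IH1 IH2]].
  under eq_fun do rewrite big_nil; rewrite big_nil; split.
    by apply: (@integ_dom R 0) => [|y]; [exact: meas_cst|rewrite mul0r normr0].
  by rewrite /rint /Rintegral integral0.
have [m1 m2] := moment n c.2.
under eq_fun do rewrite big_cons; rewrite big_cons; split.
  by apply: integD => //; exact: integZ.
by rewrite rintD ?rintZ ?m2 ?IH2//; exact: integZ.
Qed.

Let lin_cvg (cs : seq (R * nat)) :
  (fun n => \sum_(c <- cs) c.1 * moment_ratio n c.2) @ \oo --> \sum_(c <- cs) c.1.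
Proof.
elim: cs => [|c cs IH].
  by rewrite big_nil; under eq_fun do rewrite big_nil; exact: cvg_cst.
rewrite big_cons; under eq_fun do rewrite big_cons.
apply: cvgD => //; rewrite -[X in _ --> X](mulr1 c.1).
by apply: cvgM; [exact: cvg_cst|exact: cvg_moment_ratio].
Qed.

(* [eGamma (s + n + 2) / ((n + 1)! (n + 1)^s)], the expectation of [(X / (n + 1))^s] for [X] Gamma-distributed with parameter [n + 2]. *)
Definition gamma_ratio s n : C := cexp (- s) (ln n.+1%:R) * (n.+1`!%:R^-1)%:C * eGamma (s + (n.+2%:R : R)%:C).

Lemma gamma_ratioB1 s n : 0 < Re s ->
  gamma_ratio s n - 1 = cRint (fun y => (cexp s (y - L n) - 1) * (P n y)%:C).
Proof.
move=> s0; have s1 : 0 < Re (s + (n.+2%:R : R)%:C) by exact: Re_natD.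
have iG := cinteg_eGamma_kernel s1.
have [i0 r0] := moment n 0; rewrite /moment_ratio addn0 expr0 mulr1 divff in r0; last first.
  by rewrite pnatr_eq0 -lt0n fact_gt0.
have iP : cinteg (fun y => (P n y)%:C).
  split => /=; first by move: i0; under eq_fun do rewrite expr0 mul1r.
  by apply: (@integ_dom R 0) => [|y]; [exact: meas_cst|rewrite mul0r normr0].
transitivity (cRint (fun y => cexp (- s) (L n) * (n.+1`!%:R^-1)%:C * eGamma_kernel (s + (n.+2%:R : R)%:C) y
     + (-1) * (P n y)%:C)).
  rewrite cRintD ?cRintZ//; try exact: cintegZ.
  rewrite cRint_real; congr (_ + _); rewrite mulN1r; congr (- _).
  rewrite (_ : rint (P n) = 1)// -r0; apply: eq_rint => y.
  by rewrite expr0 mul1r.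
apply: eq_cRint => y; rewrite mulrBl mul1r mulN1r; congr (_ - _).
rewrite /eGamma_kernel cexpDl cexp_real cexpDr cexpNr /P !rmorphM/=; ring.
Qed.

Lemma cvg_gamma_ratio s : 0 < Re s -> (fun n => nrm (gamma_ratio s n - 1)) @ \oo --> (0 : R).
Proof.
move=> s0; apply/cvgr0Pnorm_lt => e e0.
have e4 : 0 < e / 4 by rewrite divr_gt0.
have [K [m hK]] := cexp_near1 s0 e4.
(* The expansion of [e / 4 + K (2 + x^m) (x - 1)^2] in powers of [x]. Its value at [x = 1] is
   [e / 4], and the factor 2 of [nrm_cRint] turns this into [e / 2 < e]. *)
pose cs : seq (R * nat) := [:: (e / 4, 0%N); (K * 2, 2%N); (K * - 4, 1%N); (K * 2, 0%N);
  (K, m.+2); (K * - 2, m.+1); (K, m)].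
have : (fun n => 2 * \sum_(c <- cs) c.1 * moment_ratio n c.2) @ \oo --> e / 2.
  have -> : e / 2 = 2 * \sum_(c <- cs) c.1.
    by rewrite !big_cons big_nil /=; lra.
  by apply: cvgM; [exact: cvg_cst|exact: lin_cvg].
move=> /cvgrPdist_lt/(_ _ (divr_gt0 e0 (ltr0n _ 2)))[N _ hN].
exists N => // n /hN /= hn; rewrite ger0_norm ?nrm_ge0//.
have [il rl] := lin_int n cs.
have mP : meas (P n) by rewrite /meas /P /expNexp; mea.
have dom y : nrm ((cexp s (y - L n) - 1) * (P n y)%:C) <= lin n cs y.
  rewrite nrmM nrmR ger0_norm//; apply: (le_trans (ler_wpM2r (P_ge0 n y) (hK _))).
  by rewrite /lin !big_cons big_nil /= !exprS expr0; rewrite le_eqVlt; apply/orP; left; apply/eqP; ring.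
have ci : cinteg (fun y => (cexp s (y - L n) - 1) * (P n y)%:C).
  by apply: (cinteg_le _ il) => //; apply: cmeasM; cmea.
rewrite gamma_ratioB1//; apply: (le_lt_trans (nrm_cRint ci)).
apply: (@le_lt_trans _ _ (2 * rint (lin n cs))).
  by rewrite ler_pM2l//; exact: (le_rint (integ_nrm ci) il).
by rewrite rl; move: hn; rewrite ltr_norml; lra.
Qed.

Lemma Re_gt0_neq0 s : 0 < Re s -> s != 0.
Proof. by move=> s0; apply/eqP => e; move: s0; rewrite e/= ltxx. Qed.

(** The [n + 2] factors in the denominator of [Gamma_seq] are those that carry [eGamma s] to
    [eGamma (s + n + 2)]; the factorial and the power cancel. *)
Lemma Gamma_seqM_gamma_ratio s n : 0 < Re s -> Gamma_seq s n * gamma_ratio s n = eGamma s.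
Proof.
move=> s0; rewrite /Gamma_seq /gamma_ratio -eGamma_prod// cpowE.
have p0 : \prod_(k < n.+2) (s + (k%:R : R)%:C) != 0.
  by apply/prodf_neq0 => k _; exact/Re_gt0_neq0/Re_natD.
have f0 : (n.+1`!%:R : C) != 0 by rewrite pnatr_eq0 -lt0n fact_gt0.
rewrite cexpN fmorphV/= rmorph_nat.
by field; rewrite f0 p0 cexp_neq0.
Qed.

(** A zero at [s] would propagate by the functional equation to every [s + n + 2], making
    [gamma_ratio s n] vanish for all [n], while it tends to 1. *)
Lemma eGamma_neq0 s : 0 < Re s -> eGamma s != 0.
Proof.
move=> s0; apply/eqP => G0; have := cvg_gamma_ratio s0.
rewrite (_ : (fun n => _) = fun=> 1).
  move=> /(@cvg_lim _ (@norm_hausdorff _ R)); rewrite lim_cst//.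
  by move=> /eqP; rewrite oner_eq0.
apply/funext => n; rewrite /gamma_ratio -eGamma_prod// G0 !mulr0 sub0r nrmN; exact: nrm1.
Qed.

(** The error is [Gamma_seq s n * (gamma_ratio s n - 1)] up to sign. Once
    [|gamma_ratio s n| >= 1/2], the first factor is at most [2 |eGamma s|], so the error tends to
    0. *)
Lemma cGammaE s : 0 < Re s -> cGamma s = eGamma s.
Proof.
move=> s0; have h := cvg_gamma_ratio s0.
have cv : (fun n => nrm (Gamma_seq s n - eGamma s)) @ \oo --> (0 : R).
  apply/cvgr0Pnorm_lt => e e0.
  have k0 : 0 < 2 * nrm (eGamma s) + 1 by have := nrm_ge0 (eGamma s); lra.
  move/cvgr0Pnorm_lt : h => h.
  near=> n.
  have b1 : nrm (gamma_ratio s n - 1) < 1 / 2.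
    rewrite -[ltLHS]ger0_norm ?nrm_ge0//; near: n; apply: h; lra.
  have b2 : nrm (gamma_ratio s n - 1) < e / (2 * nrm (eGamma s) + 1).
    by rewrite -[ltLHS]ger0_norm ?nrm_ge0//; near: n; apply: h; rewrite divr_gt0.
  have b3 : 1 / 2 <= nrm (gamma_ratio s n).
    have := nrmD (gamma_ratio s n) (- (gamma_ratio s n - 1)); rewrite nrmN opprB addrCA subrr addr0 nrm1.
    lra.
  rewrite ger0_norm ?nrm_ge0// -{1}(Gamma_seqM_gamma_ratio n s0).
  have -> : Gamma_seq s n - Gamma_seq s n * gamma_ratio s n = - (Gamma_seq s n * (gamma_ratio s n - 1)).
    by ring.
  rewrite nrmN nrmM.
  have b4 : nrm (Gamma_seq s n) <= 2 * nrm (eGamma s).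
    rewrite -(Gamma_seqM_gamma_ratio n s0) nrmM; have := nrm_ge0 (Gamma_seq s n); nra.
  move: b2; rewrite ltr_pdivlMr//; have := nrm_ge0 (Gamma_seq s n).
  have := nrm_ge0 (gamma_ratio s n - 1); nra.
apply: cext; rewrite /cGamma /=; apply/cvg_lim => //; apply/cvgrPdist_lt => e e0;
  move/cvgr0Pnorm_lt : cv => /(_ _ e0)[N _ hN]; exists N => // n /hN /=;
  rewrite ger0_norm ?nrm_ge0//; apply: le_lt_trans; rewrite distrC.
- by apply: le_trans (Re_nrm _); rewrite ReD ReN.
- by apply: le_trans (Im_nrm _); rewrite ImD ImN.
Unshelve. all: by end_near. Qed.

(** [Gamma(s) = Gamma(s + 2) / (s (s + 1))], and on a vertical line the numerator is bounded by an
    integral that does not involve [t]. *)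
Lemma eGamma_decay (c : R) : 0 < c ->
  exists K, 0 <= K /\ forall t, nrm (eGamma (c +i* t)) <= K / (1 + t ^+ 2).
Proof.
move=> c0; pose M : R := 2 * rint (fun y : R => expR ((c + 1 + 1) * y) * expNexp y).
have M0 : 0 <= M.
  by rewrite mulr_ge0// rint_ge0// => y; rewrite mulr_ge0 ?expR_ge0.
(* Chosen so that [a (1 + t^2) <= c^2 + t^2 = |s|^2 <= |s| |s + 1|]. *)
pose a := Num.min 1 (c ^+ 2).
have a0 : 0 < a by rewrite lt_min ltr01 exprn_gt0.
exists (M / a); split; first by rewrite divr_ge0// ltW.
move=> t; pose s : C := c +i* t.
have s0 : 0 < Re s by [].
have s1 : 0 < Re (s + 1) by rewrite ReD/= ltr_pwDl.
have s2 : 0 < Re (s + 1 + 1) by rewrite !ReD/= !ltr_pwDl// ltr_wpDr.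
have hM : nrm (eGamma (s + 1 + 1)) <= M.
  apply: (le_trans (nrm_cRint (cinteg_eGamma_kernel s2))); rewrite /M ler_pM2l//.
  by under eq_rint do rewrite nrm_eGamma_kernel; rewrite !ReD.
rewrite eGammaD1// eGammaD1// !nrmM mulrA in hM.
have n1 : nrm s <= nrm (s + 1).
  rewrite !nrmE ler_wsqrtr// ReD ImD/= addr0 lerD2r ler_sqr ?nnegrE ?(ltW c0)//; lra.
have n2 : c ^+ 2 + t ^+ 2 <= nrm (s + 1) * nrm s.
  apply: (@le_trans _ _ (nrm s * nrm s)); last by rewrite ler_wpM2r// nrm_ge0.
  by rewrite -expr2 nrmE sqr_sqrtr// addr_ge0// sqr_ge0.
have n3 : a * (1 + t ^+ 2) <= c ^+ 2 + t ^+ 2.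
  rewrite mulrDr mulr1 lerD//; first by rewrite ge_min lexx orbT.
  by rewrite ler_piMl ?sqr_ge0// ge_min lexx.
rewrite -/s -mulrA -invfM ler_pdivlMr ?mulr_gt0 ?oneDsqr_gt0//.
apply: le_trans hM; rewrite mulrC ler_wpM2r ?nrm_ge0//.
exact: le_trans n3 n2.
Qed.

Lemma continuous_rint (k : R -> R -> R) (h : R -> R) : integ h -> (forall t, meas (k t)) ->
  (forall y, continuous (k^~ y)) -> (forall t y, `|k t y| <= h y) ->
  continuous (fun t => rint (k t)).
Proof.
move=> ih mk ck kh a.
apply: (@continuity_under_integral R _ _ (@lebesgue_measure R) k setT measurableT (a - 1) (a + 1) _ _ h ih) => //.
- by move=> t _; exact: (integ_le (mk t) ih).
- by apply: aeW => y _ t _; exact: ck.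
- by move=> t _; apply: aeW => y _; exact: kh.
- by rewrite inE/= in_itv/=; apply/andP; split; lra.
Qed.

(** Measurability comes from continuity under the integral: the modulus of the kernel is the same
    for all [t], hence is its own majorant. *)
Lemma cmeas_eGamma (c : R) : 0 < c -> cmeas (fun t : R => eGamma (c +i* t)).
Proof.
move=> c0; have ih := integ_expM_expNexp c0.
split; apply: continuous_meas; rewrite /eGamma /cRint/=; apply: (continuous_rint ih).
- by move=> t; have [] := cmeas_eGamma_kernel (c +i* t).
- move=> y; apply: hasd_continuous => t; under eq_fun do rewrite /eGamma_kernel ReM Re_cexp Im_cexp/=; ders.
- by move=> t y; apply: le_trans (Re_nrm _) _; rewrite nrm_eGamma_kernel.
- by move=> t; have [] := cmeas_eGamma_kernel (c +i* t).
- move=> y; apply: hasd_continuous => t; under eq_fun do rewrite /eGamma_kernel ImM Re_cexp Im_cexp/=; ders.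
- by move=> t y; apply: le_trans (Im_nrm _) _; rewrite nrm_eGamma_kernel.
Qed.
End GammaLimit.

(** * Mellin inversion of the Gamma function *)

Section Poisson.
Variable R : realType.
Notation mu := (@lebesgue_measure R).
Implicit Types f g : R -> R.

Lemma rint_FTC_half (F f : R -> R) (l : R) :
  (forall x : R, hasd F x (f x)) -> continuous f ->
  integ (fun x => f x * \1_(`[0, +oo[%classic : set R) x) ->
  F x @[x --> +oo] --> l -> Rintegral mu (`[0, +oo[%classic) f = l - F 0.
Proof.
move=> dF cf fi Fl.
pose H : set R := `[0, +oo[%classic.
pose D n : set R := `[0, n%:R]%classic.
have measD n : measurable (D n) by exact: measurable_itv.
have mf : meas f by exact: continuous_meas.
have restrE (A : set R) : Rintegral mu A f = rint (fun x => f x * \1_A x).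
  rewrite Rintegral_mkcond; apply: eq_Rintegral => x _.
  by rewrite patchE indicE; case: (x \in A); rewrite ?mulr1 ?mulr0.
have h1 : (fun n => rint (fun x => f x * \1_(D n) x)) @ \oo --> rint (fun x => f x * \1_H x).
  apply: (rint_dct _ (integ_norm fi)).
  - by move=> n; apply: measurable_funM => //; apply: measurable_indic; exact: measD.
  - move=> x; apply: cvg_near_cst.
    exists (Num.truncn `|x|).+1 => // n /= xn.
    have xn' : `|x| <= n%:R.
      by rewrite (le_trans (ltW (truncnS_gt _)))// ler_nat.
    congr (_ * _); rewrite !indicE; congr ((_ : bool)%:R); rewrite !mem_setE !in_itv/= andbT.
    by rewrite (le_trans (ler_norm _) xn') andbT.
  - move=> n x; rewrite !normrM ler_wpM2l// !indicE !mem_setE !in_itv/= andbT.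
    by case: (0 <= x) => //=; rewrite normr1; case: (x <= _); rewrite ?normr1 ?normr0.
rewrite restrE; apply: (cvg_unique (@norm_hausdorff _ R) h1).
have h2 : (fun n : nat => F n%:R - F 0) @ \oo --> l - F 0.
  by apply: cvgB; [exact: (cvg_comp _ _ (@cvgr_idn R) Fl)|exact: cvg_cst].
apply: cvg_trans h2; apply: near_eq_cvg; exists 1 => // n /= n0.
have n0' : 0 < n%:R :> R by rewrite ltr0n.
rewrite -restrE /Rintegral (@continuous_FTC2 _ f F)//.
- by apply: continuous_subspaceT => x; exact: cf.
- have cF : continuous F by exact: (hasd_continuous dF).
  split.
  + by move=> x _; have [] := dF x.
  + by apply: cvg_at_right_filter; exact: cF.
  + by apply: cvg_at_left_filter; exact: cF.
- by move=> x _; rewrite derive1E; have [] := dF x.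
Qed.

Lemma integ_exp_abs (e : R) : 0 < e -> integ (fun t => expR (- (e * `|t|))).
Proof.
move=> e0; apply: (@integ_dom R (1 + 2 / e ^+ 2)) => [|t]; first by rewrite /meas; mea.
by rewrite ger0_norm ?expR_ge0// exp_decay.
Qed.

(** On the half-line the integrand has the explicit primitive [F]; the reflection [t -> -t] gives
    the same value on the other half. *)
Lemma poisson_cos (e a : R) : 0 < e ->
  rint (fun t => expR (- (e * `|t|)) * cos (a * t)) = 2 * e / (e ^+ 2 + a ^+ 2).
Proof.
move=> e0.
have d0 : e ^+ 2 + a ^+ 2 != 0.
  by rewrite gt_eqF// ltr_pwDl ?exprn_gt0// sqr_ge0.
pose g t := expR (- (e * `|t|)) * cos (a * t).
pose f t := expR (- (e * t)) * cos (a * t).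
pose F t := expR (- (e * t)) * (a * sin (a * t) - e * cos (a * t)) / (e ^+ 2 + a ^+ 2).
pose H : set R := `[0, +oo[%classic.
have mg : meas g by rewrite /meas /g; mea.
have ig : integ g.
  apply: (integ_le mg (integ_exp_abs e0)) => t.
  by rewrite /g normrM ger0_norm ?expR_ge0// ler_piMr ?expR_ge0// ler_norml cos_geN1 cos_le1.
have ggd_mellin : measurable H by exact: measurable_itv.
have igH : integ (fun x => g x * \1_H x).
  apply: (integ_le _ (integ_norm ig)); first exact: measurable_funM.
  by move=> x; rewrite normrM ler_piMr// indicE; case: (_ \in _); rewrite ?normr1 ?normr0.
have fg : (fun x => f x * \1_H x) = (fun x => g x * \1_H x).
  apply/funext => x; rewrite indicE mem_setE in_itv/= andbT.
  by have [x0|] := leP 0 x; rewrite ?mulr0// /f /g ger0_norm.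
have dF x : hasd F x (f x).
  apply: hasd_eq; first by rewrite /F; ders.
  by rewrite /f /=; field.
have cf : continuous f by apply: hasd_continuous => x; rewrite /f; ders.
have Fl : F x @[x --> +oo] --> 0.
  have h0 : (`|a| + e) * expR (- (e * x)) @[x --> +oo] --> 0.
    rewrite -[X in _ --> X](mulr0 (`|a| + e)); apply: cvgM; first exact: cvg_cst.
    apply: (cvg_comp (fun x => e * x) _ _ (@cvgr_expR R)).
    by apply: gt0_cvgMry => //; exact: cvg_id.
  apply/cvgr0Pnorm_lt => k k0.
  have kd : 0 < k * (e ^+ 2 + a ^+ 2).
    by rewrite mulr_gt0// lt0r d0 addr_ge0// sqr_ge0.
  move/cvgr0Pnorm_lt : h0 => /(_ _ kd); apply: filterS => x.
  have dp : 0 < e ^+ 2 + a ^+ 2 by rewrite lt0r d0 addr_ge0// sqr_ge0.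
  rewrite /F !normrM normfV (ger0_norm (ltW dp)) ltr_pdivrMr//; apply: le_lt_trans.
  rewrite mulrC ler_wpM2r// [leRHS]ger0_norm ?addr_ge0 ?(ltW e0)//.
  apply: (le_trans (ler_normB _ _)); rewrite !normrM (gtr0_norm e0) lerD//.
    by rewrite ler_piMr// ler_norml sin_geN1 sin_le1.
  by rewrite ler_piMr ?(ltW e0)// ler_norml cos_geN1 cos_le1.
have half : rint (fun x => g x * \1_H x) = e / (e ^+ 2 + a ^+ 2).
  rewrite -fg; have := rint_FTC_half dF cf _ Fl; rewrite fg => /(_ igH).
  rewrite Rintegral_mkcond sub0r /F !mulr0 oppr0 expR0 cos0 sin0 mul1r.
  rewrite mulr0 sub0r mulr1 mulNr opprK => <-.
  apply: eq_Rintegral => x _; rewrite patchE -[LHS]/((fun x => g x * \1_H x) x) -fg indicE.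
  by rewrite -/H; case: (x \in H); rewrite ?mulr1 ?mulr0.
have half' : rint (fun x => g x * \1_(~` H) x) = e / (e ^+ 2 + a ^+ 2).
  have mHC : measurable (~` H) by exact: measurableC.
  rewrite (@rint_affine R (-1) 0) ?oppr_eq0 ?oner_eq0//; last exact: measurable_funM.
  rewrite normrN normr1 mul1r -half.
  pose H' : set R := `]0, +oo[%classic.
  transitivity (Rintegral mu H' g).
    rewrite Rintegral_mkcond; apply: eq_Rintegral => x _; rewrite patchE indicE.
    rewrite mulN1r addr0 in_setC !mem_setE !in_itv/= !andbT oppr_ge0 -ltNge.
    by case: ifP; rewrite ?mulr1 ?mulr0// /g normrN mulrN cosN.
  (* Reflecting the complement of [H] gives the open half-line; adding the endpoint 0 does not
     change the integral. *)
  rewrite /H' (@Rintegral_itv_obnd_cbnd R 0 (BInfty _ false) g).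
    rewrite Rintegral_mkcond; apply: eq_Rintegral => x _; rewrite patchE indicE.
    by case: ifP; rewrite ?mulr1 ?mulr0.
  by apply: (integrableS measurableT) => //; exact: measurable_itv.
have -> : 2 * e / (e ^+ 2 + a ^+ 2) = e / (e ^+ 2 + a ^+ 2) + e / (e ^+ 2 + a ^+ 2).
  by field.
rewrite -{1}half -half' -rintD//; last first.
  apply: (integ_le _ (integ_norm ig)).
    by apply: measurable_funM => //; apply: measurable_indic; exact: measurableC.
  by move=> x; rewrite normrM ler_piMr// indicE; case: (_ \in _); rewrite ?normr1 ?normr0.
apply: eq_rint => x; rewrite -mulrDr !indicE in_setC.
by case: (x \in H); rewrite /= ?addr0 ?add0r mulr1.
Qed.

Lemma poisson_sin (e a : R) : 0 < e ->
  rint (fun t => expR (- (e * `|t|)) * sin (a * t)) = 0.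
Proof.
move=> e0; set g := (fun t => _ * _).
have mg : meas g by rewrite /meas /g; mea.
have ig : integ g.
  apply: (integ_le mg (integ_exp_abs e0)) => t.
  by rewrite /g normrM ger0_norm ?expR_ge0// ler_piMr ?expR_ge0// ler_norml sin_geN1 sin_le1.
have : rint g = - rint g.
  rewrite {1}(@rint_affine R (-1) 0) ?oppr_eq0 ?oner_eq0// normrN normr1 mul1r.
  rewrite -[RHS]mulN1r -rintZ//; apply: eq_rint => t.
  by rewrite /g mulN1r addr0 normrN mulrN sinN mulN1r mulrN.
by move=> h; lra.
Qed.

Lemma iint_prod (f g : R -> R) : integ f -> integ g ->
  (\int[mu]_x \int[mu]_y (f x * g y)%:E < +oo)%E.
Proof.
move=> fi gi.
have -> : (\int[mu]_x \int[mu]_y (f x * g y)%:E = \int[mu]_x (rint g * f x)%:E)%E.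
  apply: eq_integral => x _.
  by rewrite (rintE (integZ (f x) gi)) rintZ// mulrC.
by rewrite (rintE (integZ (rint g) fi)) ltry.
Qed.
End Poisson.

(** * Removing the damping *)

Section Inversion.
Variable R : realType.
Local Notation C := R[i].
Local Notation Re := complex.Re.
Local Notation Im := complex.Im.
Notation mu := (@lebesgue_measure R).
Local Open Scope complex_scope.

Lemma poissonC (e a : R) : 0 < e ->
  cRint (fun t => (expR (- (e * `|t|)))%:C * cexp (0 +i* t) a) = (2 * e / (e ^+ 2 + a ^+ 2))%:C.
Proof.
move=> e0; apply: cext; rewrite cRintE/=.
- rewrite -[RHS](poisson_cos a e0); apply: eq_rint => t.
  by rewrite ReM Re_cexp Im_cexp/= !mul0r expR0 mul1r subr0 [t * a]mulrC.
- rewrite -[RHS](poisson_sin a e0); apply: eq_rint => t.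
  by rewrite ImM Re_cexp Im_cexp/= !mul0r expR0 mul1r addr0 [t * a]mulrC.
Qed.

(** After inserting Euler's integral and exchanging, the [t]-integral is the Poisson kernel of width
    [e] centred at [y]. The substitution [u = e v + y] moves [e] out of the weight, leaving the
    fixed density [2 / (1 + v^2)], so that the limit in [e] becomes a dominated one. *)
Lemma eGamma_regularized_inversion (c y e : R) : 0 < c -> 0 < e ->
  cRint (fun t => eGamma (c +i* t) * cexp (- (c +i* t)) y * (expR (- (e * `|t|)))%:C) =
  (rint (fun v => expR (c * (e * v)) * expNexp (e * v + y) * (2 / (1 + v ^+ 2))))%:C.
Proof.
move=> c0 e0.
pose A u : R := expR (c * (u - y)) * expNexp u.
pose B (t : R) : R := expR (- (e * `|t|)).
pose k t u : C := (A u * B t)%:C * cexp (0 +i* t) (u - y).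
have iA : integ A.
  have := integZ (expR (- (c * y))) (integ_expM_expNexp c0).
  by under eq_fun do rewrite mulrA -expRD addrC -mulrBr.
have iB : integ B by exact: integ_exp_abs.
have mA := integ_meas iA; have mB := integ_meas iB.
have A0 u : 0 <= A u by rewrite mulr_ge0 ?expR_ge0.
have B0 u : 0 <= B u by rewrite expR_ge0.
transitivity (cRint (fun t => cRint (k t))).
  apply: eq_cRint => t.
  rewrite -mulrA mulrC /eGamma -cRintZ; last exact: cinteg_eGamma_kernel.
  apply: eq_cRint => u; rewrite /k /A /B /eGamma_kernel.
  have -> : (c +i* t) = c%:C + (0 +i* t) by apply: cext; rewrite /= ?addr0 ?add0r.
  rewrite -cexpNr !cexpDl !cexpDr !cexp_real !mulrDr !expRD !rmorphM/=; ring.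
rewrite cfubini; first last.
- rewrite (_ : (fun x => _) = fun t => \int[mu]_u (B t * A u)%:E)%E.
    exact: iint_prod.
  apply/funext => t; apply: eq_integral => u _.
  congr EFin; rewrite [RHS]mulrC /k nrmM nrmR nrm_cexp.
  by rewrite /= mul0r expR0 mulr1 ger0_norm// mulr_ge0.
- apply: cmeasM.
    apply: cmeasR; apply: measM; [exact: (meas_comp mA (@meas_snd R))|exact: (meas_comp mB (@meas_fst R))].
  by cmea.
transitivity (cRint (fun u => (A u * (2 * e / (e ^+ 2 + (u - y) ^+ 2)))%:C)).
  apply: eq_cRint => u; rewrite rmorphM/= -(poissonC (u - y) e0) -cRintZ.
    by apply: eq_cRint => t; rewrite /k rmorphM mulrA.
  apply: (cinteg_le _ iB) => [|t]; first by cmea.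
  by rewrite nrmM nrmR nrm_cexp/= mul0r expR0 mulr1 ger0_norm.
rewrite cRint_real (@rint_affine R e y) ?gt_eqF//; last first.
  apply: measM => //; apply: measM; first exact: meas_cst.
  apply: (@continuous_meas R (fun u => (e ^+ 2 + (u - y) ^+ 2)^-1)) => u.
  apply: cvgV; first by rewrite gt_eqF// ltr_pwDl ?exprn_gt0// sqr_ge0.
  apply: cvgD; first exact: cvg_cst.
  by apply: (@hasd_continuous R (fun u => (u - y) ^+ 2)) => v; rewrite (_ : (fun _ => _) = fun u => (u - y) * (u - y)) ?funeqE//; ders.
rewrite gtr0_norm// -rintZ.
  congr (_%:C); apply: eq_rint => v; rewrite /A addrK [e * v + y]addrC.
  have -> : e ^+ 2 + (e * v) ^+ 2 = e ^+ 2 * (1 + v ^+ 2) by ring.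
  have h2 : 1 + v ^+ 2 != 0 by rewrite gt_eqF// oneDsqr_gt0.
  by field; rewrite h2 gt_eqF.
have bnd v : 0 <= 2 * e / (e ^+ 2 + (e * v) ^+ 2) <= 2 / e.
  have h1 : 0 < e ^+ 2 + (e * v) ^+ 2 by rewrite ltr_pwDl ?exprn_gt0// sqr_ge0.
  rewrite divr_ge0 ?mulr_ge0 ?(ltW e0) ?(ltW h1)//= ler_pdivrMr// mulrAC ler_pdivlMr//.
  by rewrite -mulrA -expr2 ler_pM2l// lerDl sqr_ge0.
have iA' := integ_affine y (lt0r_neq0 e0) iA.
apply: (integ_le _ (integZ (2 / e) iA')) => [|v].
  apply: measM; first exact: (integ_meas iA').
  apply: measM; first exact: meas_cst.
  apply: (@continuous_meas R (fun v => (e ^+ 2 + (e * v + y - y) ^+ 2)^-1)) => v.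
  apply: cvgV; first by rewrite gt_eqF// ltr_pwDl ?exprn_gt0// sqr_ge0.
  apply: cvgD; first exact: cvg_cst.
  apply: (@hasd_continuous R (fun u => (e * u + y - y) ^+ 2)) => w.
  by rewrite (_ : (fun _ => _) = fun u => (e * u + y - y) * (e * u + y - y)) ?funeqE//; ders.
rewrite addrK; have /andP[b1 b2] := bnd v.
rewrite ger0_norm; last by apply: mulr_ge0.
by rewrite mulrC ler_wpM2r.
Qed.

Lemma cvg_mul1 (u : nat -> R) (a : R) : u @ \oo --> (1 : R) -> (fun n => a * u n) @ \oo --> a.
Proof. by move=> h; have := cvgM (cvg_cst a) h; rewrite mulr1; apply. Qed.

(** Both sides of the regularised identity converge along [e = 1 / (n + 1)]: the left by the
    quadratic decay of Gamma, the right because the mass of [2 / (1 + v^2)] is [2 pi] and the rest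
    of its integrand tends to [expNexp y]. *)
Lemma eGamma_inversion (c y : R) : 0 < c ->
  cRint (fun t => eGamma (c +i* t) * cexp (- (c +i* t)) y) = (2 * pi * expNexp y)%:C.
Proof.
move=> c0; pose e n : R := n.+1%:R^-1.
have e0 n : 0 < e n by rewrite invr_gt0 ltr0n.
have ecv : e @ \oo --> (0 : R) by exact: (@cvg_harmonic R).
pose z t : C := eGamma (c +i* t) * cexp (- (c +i* t)) y.
pose I n := cRint (fun t => z t * (expR (- (e n * `|t|)))%:C).
have [K [K0 hK]] := eGamma_decay c0.
have mz : cmeas z by apply: cmeasM; [exact: cmeas_eGamma|cmea].
have zb t : nrm (z t) <= (K * expR (- (c * y))) / (1 + t ^+ 2).
  by rewrite nrmM nrm_cexp/= mulNr mulrAC ler_wpM2r ?expR_ge0//; exact: hK.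
have iz : integ (fun t => K * expR (- (c * y)) / (1 + t ^+ 2)).
  exact: (integZ _ (@integ_inv1Dsqr R)).
have ez t : (fun n => expR (- (e n * `|t|))) @ \oo --> (1 : R).
  rewrite -[X in _ --> X](@expR0 R); apply: continuous_cvg; first exact: continuous_expR.
  rewrite -[X in _ --> X](oppr0); apply: cvgN; rewrite -(mul0r `|t|).
  by apply: cvgM => //; exact: cvg_cst.
have ele1 n t : expR (- (e n * `|t|)) <= 1.
  by rewrite expR_le1 oppr_le0 mulr_ge0// ltW.
have ReI : (fun n => Re (I n)) @ \oo --> Re (cRint z).
  apply: (rint_dct _ iz) => [n|t|n t].
  - have [] : cmeas (fun t => z t * (expR (- (e n * `|t|)))%:C) by apply: cmeasM => //; cmea.
    by [].
  - under eq_fun do rewrite ReM/= mulr0 subr0.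
    exact: cvg_mul1.
  - apply: le_trans (Re_nrm _) _; rewrite nrmM nrmR ger0_norm ?expR_ge0//.
    by apply: le_trans (zb t); rewrite ler_piMr ?nrm_ge0.
have ImI : (fun n => Im (I n)) @ \oo --> Im (cRint z).
  apply: (rint_dct _ iz) => [n|t|n t].
  - have [] : cmeas (fun t => z t * (expR (- (e n * `|t|)))%:C) by apply: cmeasM => //; cmea.
    by [].
  - under eq_fun do rewrite ImM/= mulr0 add0r.
    exact: cvg_mul1.
  - apply: le_trans (Im_nrm _) _; rewrite nrmM nrmR ger0_norm ?expR_ge0//.
    by apply: le_trans (zb t); rewrite ler_piMr ?nrm_ge0.
have [M [M0 hM]] := expNexp_bound c0.
(* The factor [e^(-c y)] comes from writing [w = (w + y) - y], which reduces the bound to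
   [expNexp_bound] at [w + y]. *)
pose B : R := expR (- (c * y)) * M.
have hB w : expR (c * w) * expNexp (w + y) <= B.
  have -> : expR (c * w) = expR (- (c * y)) * expR (c * (w + y)).
    by rewrite -expRD; congr expR; ring.
  rewrite -mulrA /B ler_pM2l ?expR_gt0//; apply: (le_trans (hM _)).
  by rewrite ler_pdivrMr ?oneDsqr_gt0// ler_peMr ?(ltW M0)// lerDl sqr_ge0.
have IE n : I n = (rint (fun v => expR (c * (e n * v)) * expNexp (e n * v + y) * (2 / (1 + v ^+ 2))))%:C.
  exact: eGamma_regularized_inversion.
have minv : meas (fun v : R => (1 + v ^+ 2)^-1) by exact: integ_meas (@integ_inv1Dsqr R).
have RI : (fun n => Re (I n)) @ \oo --> 2 * pi * expNexp y.
  under eq_fun do rewrite IE/=.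
  have -> : 2 * pi * expNexp y = rint (fun v => expNexp y * (2 / (1 + v ^+ 2))).
    under eq_rint do rewrite mulrA.
    by rewrite rintZ ?rint_inv1Dsqr; [ring|exact: integ_inv1Dsqr].
  have ib : integ (fun v => B * 2 / (1 + v ^+ 2)) by exact: (integZ _ (@integ_inv1Dsqr R)).
  apply: (rint_dct _ ib) => [n|v|n v].
  - rewrite /meas /expNexp; apply: measM; first by mea.
    by apply: measM => //; exact: meas_cst.
  - apply: cvgM; last exact: cvg_cst.
    have cw : continuous (fun w : R => expR (c * w) * expNexp (w + y)).
      by apply: hasd_continuous => w; rewrite /expNexp; ders.
    have h0 : (fun n => e n * v) @ \oo --> (0 : R).
      by have := cvgM ecv (cvg_cst v); rewrite mul0r; apply.
    by have := cvg_comp _ _ h0 (cw 0); rewrite /= mulr0 expR0 mul1r add0r; apply.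
  - rewrite ger0_norm; last by rewrite !mulr_ge0 ?expR_ge0// invr_ge0 ltW// oneDsqr_gt0.
    by rewrite -[leRHS]mulrA ler_wpM2r ?divr_ge0 ?(ltW (oneDsqr_gt0 _)).
have I0 : (fun n => Im (I n)) @ \oo --> (0 : R).
  by under eq_fun do rewrite IE/=; exact: cvg_cst.
apply: cext; rewrite -/z.
- exact: (cvg_unique (@norm_hausdorff _ R) ReI RI).
- exact: (cvg_unique (@norm_hausdorff _ R) ImI I0).
Qed.

(** Inversion at abscissa [(1 + 2 c1) / a] with [y = a l], after rescaling [t] by [2 / a]; the
    rescaling turns [2 pi] into [a pi]. The abscissa is positive exactly when [c1 > -1/2]. *)
Lemma expNexp_mellin (a c1 l : R) : 0 < a -> - (1 / 2) < c1 ->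
  cRint (fun t => eGamma ((1 / a)%:C + (2 / a)%:C * (c1 +i* t)) * cexp (- (1 + 2 * (c1 +i* t))) l)
  = (a * pi * expNexp (a * l))%:C.
Proof.
move=> a0 hc; pose c := (1 + 2 * c1) / a.
have c0 : 0 < c by rewrite divr_gt0//; lra.
have a1 : a != 0 by rewrite gt_eqF.
pose z t : C := eGamma (c +i* t) * cexp (- (c +i* t)) (a * l).
have mz : cmeas z by apply: cmeasM; [exact: cmeas_eGamma|cmea].
have h : 2 / a != 0 by rewrite mulf_neq0// invr_eq0.
have := eGamma_inversion (a * l) c0; rewrite (cRint_affine 0 h mz).
have hp : 0 < 2 / a by rewrite divr_gt0.
rewrite gtr0_norm// => e1.
have e2 : cRint (fun t => z (2 / a * t + 0)) = (a * pi * expNexp (a * l))%:C.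
  have h' : (2 / a)%:C != 0 by apply/eqP => /complexI/eqP; exact/negP.
  apply: (mulfI h'); rewrite e1 -rmorphM; congr (_%:C); field; exact: a1.
rewrite -e2; apply: eq_cRint => t; rewrite /z addr0 cexpMr; congr (eGamma _ * cexp _ _).
  by apply: cext; rewrite !ReImE/= /c; field.
by apply: cext; rewrite !ReImE/= /c; field.
Qed.
End Inversion.

(** * Beta and Riesz integrals *)

Section BetaIntegral.
Variable R : realType.
Local Notation C := R[i].
Local Notation Re := complex.Re.
Local Notation Im := complex.Im.
Notation mu := (@lebesgue_measure R).
Implicit Types (a b s w : C) (x v r p : R).
Local Open Scope complex_scope.

Lemma int_shift (f : R -> R) (b : R) : meas f -> (forall x, 0 <= f x) ->
  (\int[mu]_x (f (x + b))%:E = \int[mu]_x (f x)%:E)%E.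
Proof.
move=> mf f0.
rewrite [RHS](@ge0_int_affine R 1 b) ?oner_eq0//.
- rewrite normr1 mul1e; apply: eq_integral => x _; by rewrite mul1r.
- exact: meas_EFin.
Qed.

(** Yields integrability of [f] with no direct estimate: the finite double integral is obtained by
    Tonelli in the other order, where the integrals are explicit. *)
Lemma cinteg_of_iint (k : R -> R -> C) (f : R -> C) (c : R) : cmeas f -> 0 < c ->
  (forall x, \int[mu]_p (nrm (k x p))%:E = (c * nrm (f x))%:E)%E ->
  (\int[mu]_x \int[mu]_p (nrm (k x p))%:E < +oo)%E -> cinteg f.
Proof.
move=> mf c0 kE; under eq_integral do rewrite kE.
move=> fi; have m1 := meas_nrm mf.
have : integ (fun x => c * nrm (f x)).
  apply/integ_ge0P => //; first by apply: measM => //; exact: meas_cst.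
  by move=> x; rewrite mulr_ge0 ?nrm_ge0// ltW.
move=> /(integZ c^-1) h; apply: (cinteg_le mf h) => x.
by rewrite mulrA mulVf ?mul1r// gt_eqF.
Qed.

Lemma int_nrm (f : R -> C) : cinteg f ->
  (\int[mu]_x (nrm (f x))%:E = (rint (fun x => nrm (f x)))%:E)%E.
Proof. by move=> fi; rewrite (rintE (integ_nrm fi)). Qed.

Lemma cinteg_shift (f : R -> C) (b : R) : cinteg f -> cinteg (fun x => f (x + b)).
Proof.
move=> [h1 h2].
have g1 := integ_affine b (oner_neq0 R) h1; have g2 := integ_affine b (oner_neq0 R) h2.
by split; [move: g1|move: g2]; under eq_fun do rewrite mul1r.
Qed.

Lemma cRint_shiftZ (z : C) (f : R -> C) (b : R) : cinteg f ->
  cRint (fun x => z * f (x + b)) = z * cRint f.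
Proof.
by move=> fi; rewrite (cRintZ z (cinteg_shift b fi)) (cRint_shift b (cinteg_cmeas fi)).
Qed.

Lemma cRint_eGamma_kernel_shift (z : C) s (x : R) : 0 < Re s ->
  cRint (fun p : R => z * eGamma_kernel s (p + x)) = z * eGamma s.
Proof. by move=> s0; exact: (cRint_shiftZ z x (cinteg_eGamma_kernel s0)). Qed.

Lemma cmeas_comp d (T : measurableType d) (g : R -> C) (f : T -> R) :
  cmeas g -> measurable_fun setT f -> cmeas (fun z => g (f z)).
Proof. by move=> [g1 g2] mf; split; [exact: (meas_comp g1 mf)|exact: (meas_comp g2 mf)]. Qed.

Definition softplus r : R := ln (1 + expR r).
Lemma expR_softplus r : expR (softplus r) = 1 + expR r.
Proof. by rewrite lnK// posrE addr_gt0// expR_gt0. Qed.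
Lemma softplus_ge0 r : 0 <= softplus r.
Proof. by rewrite ln_ge0// lerDl expR_ge0. Qed.
Lemma softplus_ge r : r <= softplus r.
Proof. by rewrite -ler_expR expR_softplus lerDr. Qed.
Lemma meas_softplus : meas softplus.
Proof. by rewrite /meas /softplus; mea. Qed.

(** The integrand of [B(a, b)] in the form [t^(b-1) (1 + t)^(-a-b) dt] on the half-line, with
    [t = e^r]. *)
Definition beta_kernel a b r : C := cexp b r * cexp (- (a + b)) (softplus r).

Lemma cmeas_beta_kernel a b : cmeas (beta_kernel a b).
Proof. by apply: cmeasM; apply: cmeas_cexp; [exact: cmeas_cst|exact: meas_id|exact: cmeas_cst|exact: meas_softplus]. Qed.

Lemma cinteg_beta_kernel a b : 0 < Re a -> 0 < Re b -> cinteg (beta_kernel a b).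
Proof.
move=> a0 b0; pose m := Num.min (Re a) (Re b).
have m0 : 0 < m by rewrite lt_min a0.
apply: (cinteg_le (cmeas_beta_kernel a b) (integ_exp_abs m0)) => r.
rewrite nrmM !nrm_cexp -expRD ler_expR ReN ReD.
have := softplus_ge r; have := softplus_ge0 r.
have ma : m <= Re a by rewrite ge_min lexx.
have mb : m <= Re b by rewrite ge_min lexx orbT.
have [r0|r0] := leP 0 r; [rewrite ger0_norm//|rewrite ltr0_norm//]; nra.
Qed.

(** [r] is the logarithm of the ratio of the two Euler variables. Their sum is
    [e^p (1 + e^r) = e^(p + softplus r)], so the two exponentials merge into a single kernel
    translated by [softplus r]. *)
Lemma eGamma_kernel_mul a b p r : eGamma_kernel a p * eGamma_kernel b (r + p) = beta_kernel a b r * eGamma_kernel (a + b) (p + softplus r).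
Proof.
rewrite /eGamma_kernel /beta_kernel /expNexp [r + p]addrC !expRD expR_softplus !cexpDr.
have -> : - (expR p * (1 + expR r)) = - expR p + - (expR p * expR r) by ring.
rewrite expRD rmorphM/= !cexpDl.
have e : cexp (- (a + b)) (softplus r) * (cexp a (softplus r) * cexp b (softplus r)) = 1 by rewrite -cexpDl cexpNM.
rewrite -[LHS]mulr1 -e; ring.
Qed.

Lemma beta_integral a b : 0 < Re a -> 0 < Re b ->
  eGamma (a + b) * cRint (beta_kernel a b) = eGamma a * eGamma b.
Proof.
move=> a0 b0; have ab0 : 0 < Re (a + b) by rewrite ReD addr_gt0.
have ia := cinteg_eGamma_kernel a0; have ib := cinteg_eGamma_kernel b0; have iab := cinteg_eGamma_kernel ab0.
pose k p r := eGamma_kernel a p * eGamma_kernel b (r + p).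
transitivity (cRint (fun p => cRint (k p))); last first.
  rewrite mulrC /eGamma -cRintZ//; apply: eq_cRint => p.
  by rewrite [LHS](cRint_eGamma_kernel_shift _ _ b0) mulrC.
rewrite cfubini.
- rewrite -cRintZ; last exact: cinteg_beta_kernel.
  apply: eq_cRint => r; under eq_cRint do rewrite /k eGamma_kernel_mul.
  by rewrite (cRint_eGamma_kernel_shift _ _ ab0) mulrC.
- by apply: cmeasM; apply: (cmeas_comp (cmeas_eGamma_kernel _)); mea.
- have [na nb] := (integ_nrm ia, integ_nrm ib).
  have -> : (\int[mu]_x \int[mu]_y (nrm (k x y))%:E =
      \int[mu]_x \int[mu]_y (nrm (eGamma_kernel a x) * nrm (eGamma_kernel b y))%:E)%E.
    apply: eq_integral => p _.
    rewrite -(@int_shift (fun y => nrm (eGamma_kernel a p) * nrm (eGamma_kernel b y)) p).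
    + by apply: eq_integral => r _; rewrite nrmM.
    + by apply: measM; [exact: meas_cst|exact: integ_meas].
    + by move=> y; rewrite mulr_ge0 ?nrm_ge0.
  exact: iint_prod.
Qed.

Lemma rint_gauss p : integ (fun x => expR (- (expR p * x ^+ 2))) /\
  rint (fun x => expR (- (expR p * x ^+ 2))) = Num.sqrt pi * expR (- (p / 2)).
Proof.
have ig : integ (@gauss_fun R) by exact: integrableT_gauss.
have e0 : expR (p / 2) != 0 by rewrite gt_eqF// expR_gt0.
have E x : gauss_fun (expR (p / 2) * x + 0) = expR (- (expR p * x ^+ 2)).
  by rewrite /gauss_fun addr0 exprMn -expRM_natr divfK// pnatr_eq0.
split; first by have := integ_affine 0 e0 ig; under eq_fun do rewrite E.
have : rint (@gauss_fun R) = Num.sqrt pi by rewrite /rint /Rintegral integralT_gauss.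
rewrite (rint_affine 0 e0 (integ_meas ig)) ger0_norm ?expR_ge0// => <-.
by rewrite (eq_rint (g := fun x => expR (- (expR p * x ^+ 2))) E) mulrAC -expRD subrr expR0 mul1r.
Qed.

Definition cauchy_kernel s x : C := cexp (- s) (ln (1 + x ^+ 2)).

Lemma cmeas_cauchy_kernel s : cmeas (cauchy_kernel s).
Proof. by rewrite /cauchy_kernel; cmea. Qed.

(** Euler's integral writes [Gamma(s) (1 + x^2)^(-s)] as a superposition of Gaussians in [x].
    Integrating over [x] first produces [sqrt pi] and lowers the exponent of the Euler variable by
    1/2. The same computation with moduli gives integrability. *)
Lemma cauchy_integral s : 1 / 2 < Re s -> cinteg (cauchy_kernel s) /\
  eGamma s * cRint (cauchy_kernel s) = (Num.sqrt pi)%:C * eGamma (s - (1 / 2)%:C).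
Proof.
move=> hs; have s0 : 0 < Re s by lra.
have s1 : 0 < Re (s - (1 / 2)%:C) by rewrite ReD ReN/=; lra.
have is0 := cinteg_eGamma_kernel s0; have is1 := cinteg_eGamma_kernel s1.
pose k x p : C := cauchy_kernel s x * eGamma_kernel s (p + ln (1 + x ^+ 2)).
have kE x p : k x p = eGamma_kernel s p * (expR (- (expR p * x ^+ 2)))%:C.
  rewrite /k /cauchy_kernel /eGamma_kernel cexpDr /expNexp expRD lnK ?posrE ?oneDsqr_gt0//.
  have -> : - (expR p * (1 + x ^+ 2)) = - expR p + - (expR p * x ^+ 2) by ring.
  rewrite expRD rmorphM/=.
  rewrite -[RHS]mulr1 -(cexpNM s (ln (1 + x ^+ 2))); ring.
have mk : cmeas (fun z : R * R => k z.1 z.2).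
  under eq_fun do rewrite kE; apply: cmeasM; last by cmea.
  exact: (cmeas_comp (cmeas_eGamma_kernel s) (@meas_snd R)).
have inner p : integ (fun x => nrm (k x p)) /\
   rint (fun x => nrm (k x p)) = Num.sqrt pi * (nrm (eGamma_kernel (s - (1 / 2)%:C) p)).
  have [g1 g2] := rint_gauss p.
  under eq_fun do rewrite kE nrmM nrmR ger0_norm ?expR_ge0//.
  split; first exact: integZ.
  rewrite rintZ// g2 !nrm_eGamma_kernel mulrCA; congr (_ * _); rewrite mulrAC -expRD.
  by congr (expR _ * _); rewrite ReD ReN/=; ring.
have fin : (\int[mu]_x \int[mu]_p (nrm (k x p))%:E < +oo)%E.
  rewrite tonelli; last by move=> x p; rewrite lee_fin nrm_ge0.
    under eq_integral => p _ do rewrite (rintE (inner p).1) (inner p).2.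
    by rewrite (rintE (integZ _ (integ_nrm is1))) ltry.
  by apply/measurable_EFinP; exact: meas_nrm mk.
pose c := rint (fun p => nrm (eGamma_kernel s p)).
have c0 : 0 < c.
  have := nrm_cRint is0; have := nrm_gt0 (eGamma_neq0 s0); rewrite /eGamma -/c; lra.
have icau : cinteg (cauchy_kernel s).
  apply: (@cinteg_of_iint k _ c) => //; first exact: cmeas_cauchy_kernel.
  move=> x; under eq_integral do rewrite nrmM.
  rewrite (@int_shift (fun p => nrm (cauchy_kernel s x) * nrm (eGamma_kernel s p))).
  - by rewrite (rintE (integZ _ (integ_nrm is0))) rintZ 1?mulrC//; exact: integ_nrm.
  - by apply: measM; [exact: meas_cst|apply: integ_meas; exact: integ_nrm].
  - by move=> y; rewrite mulr_ge0 ?nrm_ge0.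
split => //.
transitivity (cRint (fun x => cRint (k x))).
  rewrite -cRintZ//; apply: eq_cRint => x.
  by rewrite [RHS](cRint_eGamma_kernel_shift _ _ s0) mulrC.
rewrite cfubini// /eGamma -cRintZ//; apply: eq_cRint => p.
have [g1 g2] := rint_gauss p.
under eq_cRint do rewrite kE.
rewrite cRintZ; last first.
  split => //=; apply: (@integ_dom R 0) => [|y]; first exact: meas_cst.
  by rewrite mul0r normr0.
rewrite cRint_real g2 /eGamma_kernel rmorphM/= cexpDl -rmorphN/= cexp_real.
by have -> : - (1 / 2) * p = - (p / 2) by [ring]; ring.
Qed.

Definition neq0_ind x : R := (x != 0)%:R.
Lemma meas_neq0_ind : meas neq0_ind.
Proof.
have -> : neq0_ind = \1_(~` [set (0 : R)]).
  apply/funext => x; rewrite indicE /neq0_ind in_setC; congr ((_ : bool)%:R).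
  by congr (~~ _); apply/eqP/idP => [->|]; rewrite inE.
by apply: measurable_indic; apply: measurableC; exact: measurable_set1.
Qed.
Lemma neq0_ind_ge0 x : 0 <= neq0_ind x. Proof. by rewrite /neq0_ind ler0n. Qed.
Lemma neq0_ind_le1 x : neq0_ind x <= 1. Proof. by rewrite /neq0_ind lern1 leq_b1. Qed.

Lemma ae_eq_off2 (f g : R -> \bar R) (a b : R) :
  (forall x, x != a -> x != b -> f x = g x) -> ae_eq mu setT f g.
Proof.
move=> fg; have ab0 : mu.-negligible [set a; b].
  have n1 (c : R) : mu.-negligible [set c].
    by apply/(@negligibleP _ _ _ mu _ (measurable_set1 c)); exact: lebesgue_measure_set1.
  by apply: negligibleU; exact: n1.
apply: negligibleS ab0 => x /= nfg; apply: contrapT => /not_orP[/eqP xa /eqP xb].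
by apply: nfg => _; exact: fg.
Qed.

Lemma rint_off2 (f g : R -> R) (a b : R) : meas f -> meas g ->
  (forall x, x != a -> x != b -> f x = g x) -> rint f = rint g.
Proof.
move=> mf mg fg; congr fine; apply: ae_eq_integral => //.
- exact: meas_EFin.
- exact: meas_EFin.
- by apply: (ae_eq_off2 (a := a) (b := b)) => x xa xb; rewrite fg.
Qed.

Lemma cRint_off2 (f g : R -> C) (a b : R) : cmeas f -> cmeas g ->
  (forall x, x != a -> x != b -> f x = g x) -> cRint f = cRint g.
Proof.
move=> [f1 f2] [g1 g2] fg; apply: cext; rewrite !cRintE/=.
- by apply: (rint_off2 (a := a) (b := b)) => // x xa xb; rewrite fg.
- by apply: (rint_off2 (a := a) (b := b)) => // x xa xb; rewrite fg.
Qed.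
End BetaIntegral.

(** * The integral of a product of two powers *)

Section Riesz.
Variable R : realType.
Local Notation C := R[i].
Local Notation Re := complex.Re.
Local Notation Im := complex.Im.
Notation mu := (@lebesgue_measure R).
Implicit Types (a b s w : C) (x r p : R).
Local Open Scope complex_scope.

Lemma cmeas_section (f : R -> R -> C) : cmeas (fun z : R * R => f z.1 z.2) ->
  forall r, cmeas (fun x => f x r).
Proof.
move=> [m1 m2] r; split.
- apply: (measurableT_comp (g := fun x : R => (x, r)) m1).
  by apply: measurable_fun_pair; [exact: meas_id|exact: meas_cst].
- apply: (measurableT_comp (g := fun x : R => (x, r)) m2).
  by apply: measurable_fun_pair; [exact: meas_id|exact: meas_cst].
Qed.

(* [|x|^(-2a)]; the factor [neq0_ind x] gives the value 0 at the origin, where [ln 0 = 0] would give 1. *)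
Definition normpow2 : C -> R -> C := locked (fun a x => (neq0_ind x)%:C * cexp (- a) (ln (x ^+ 2))).

Lemma normpow2E a x : normpow2 a x = (neq0_ind x)%:C * cexp (- a) (ln (x ^+ 2)).
Proof. by rewrite /normpow2 -lock. Qed.

Lemma cmeas_normpow2 a : cmeas (normpow2 a).
Proof.
have -> : normpow2 a = fun x => (neq0_ind x)%:C * cexp (- a) (ln (x ^+ 2)).
  by apply/funext => x; rewrite normpow2E.
by apply: cmeasM; [apply: cmeasR; exact: meas_neq0_ind|apply: cmeas_cexp; [exact: cmeas_cst|mea]].
Qed.

Lemma neq0_ind_eq0 : neq0_ind (0 : R) = 0. Proof. by rewrite /neq0_ind eqxx. Qed.
Lemma neq0_ind_eq1 x : x != 0 -> neq0_ind x = 1. Proof. by rewrite /neq0_ind => ->. Qed.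

Lemma sqr_gt0 x : x != 0 -> 0 < x ^+ 2.
Proof. by move=> x0; rewrite lt0r sqrf_eq0 x0 sqr_ge0. Qed.

Variable v : R.
Hypothesis v0 : v != 0.
Let lv : R := ln `|v|.

Let expR_lv : expR lv = `|v|.
Proof. by rewrite lnK// posrE normr_gt0. Qed.

Definition ln_quad (r x : R) : R := ln (x ^+ 2 + expR r * (v - x) ^+ 2).
(** For the quadratic under the logarithm in [ln_quad r], [ce r] is the point of minimum, [lD r] the
    logarithm of the minimum [v^2 e^r / (1 + e^r)], and [S r] the dilation, with [S^2] equal to the
    leading coefficient [1 + e^r] divided by the minimum. *)
Let lD r : R := 2 * lv + r - softplus r.
Let S r : R := expR (softplus r - r / 2 - lv).
Let ce r : R := v * expR (r - softplus r).

Let quad_pos r x : 0 < x ^+ 2 + expR r * (v - x) ^+ 2.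
Proof.
have [->|x0] := eqVneq x 0.
  by rewrite expr0n/= add0r subr0 mulr_gt0 ?expR_gt0// sqr_gt0.
by rewrite ltr_pwDl ?sqr_gt0// mulr_ge0 ?expR_ge0// sqr_ge0.
Qed.

(* Completing the square: for fixed [r] the quadratic is a dilated and translated [1 + x ^+ 2]. *)
Let quadE r x : ln_quad r x = lD r + ln (1 + (S r * x + - (S r * ce r)) ^+ 2).
Proof.
apply: expR_inj; rewrite expRD /ln_quad !lnK ?posrE ?quad_pos ?oneDsqr_gt0//.
have eD : expR (lD r) = v ^+ 2 * expR r / (1 + expR r).
  rewrite /lD expRB expRD expR_softplus expRM_natl expR_lv real_normK ?num_real//.
have eSD : expR (lD r) * S r ^+ 2 = 1 + expR r.
  rewrite /lD /S -expRM_natr -expRD -expR_softplus; congr expR.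
  by have -> : (softplus r - r / 2 - lv) * 2%:R = 2 * softplus r - r - 2 * lv by [field]; ring.
have ec : ce r * (1 + expR r) = v * expR r.
  by rewrite /ce -mulrA -expR_softplus -expRD subrK.
have e1 : 1 + expR r != 0 by rewrite gt_eqF// addr_gt0// expR_gt0.
have -> : S r * x + - (S r * ce r) = S r * (x - ce r) by ring.
have -> : expR (lD r) * (1 + (S r * (x - ce r)) ^+ 2) =
  expR (lD r) + (expR (lD r) * S r ^+ 2) * (x - ce r) ^+ 2 by ring.
rewrite eSD eD.
have -> : ce r = v * expR r / (1 + expR r) by rewrite -ec mulfK.
by field.
Qed.

Let S_neq0 r : S r != 0. Proof. by rewrite gt_eqF// expR_gt0. Qed.

Let quadC s r x : cexp (- s) (ln_quad r x) = cexp (- s) (lD r) * cauchy_kernel s (S r * x + - (S r * ce r)).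
Proof. by rewrite quadE cexpDr. Qed.

Let quad_int s r : 1 / 2 < Re s -> cinteg (fun x => cexp (- s) (ln_quad r x)) /\
  cRint (fun x => cexp (- s) (ln_quad r x)) =
  cexp (- s) (lD r) * (expR (lv + r / 2 - softplus r))%:C * cRint (cauchy_kernel s).
Proof.
move=> hs; have [ic _] := cauchy_integral hs.
have is_ : cinteg (fun x => cauchy_kernel s (S r * x + - (S r * ce r))).
  have [i1 i2] := ic; split.
  - exact: (integ_affine (- (S r * ce r)) (S_neq0 r) i1).
  - exact: (integ_affine (- (S r * ce r)) (S_neq0 r) i2).
under eq_fun do rewrite quadC; split; first exact: cintegZ.
rewrite cRintZ// -mulrA; congr (_ * _).
rewrite (cRint_affine (- (S r * ce r)) (S_neq0 r) (cmeas_cauchy_kernel s)) mulrA -rmorphM/=.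
rewrite ger0_norm ?expR_ge0// /S -expRD.
have -> : lv + r / 2 - softplus r + (softplus r - r / 2 - lv) = 0 by ring.
by rewrite expR0 mul1r.
Qed.

Let quad_nrm s r : 1 / 2 < Re s ->
  (\int[mu]_x (nrm (cexp (- s) (ln_quad r x)))%:E =
   (expR (- Re s * lD r) * expR (lv + r / 2 - softplus r) * rint (fun x => nrm (cauchy_kernel s x)))%:E)%E.
Proof.
move=> hs; have [iq _] := quad_int r hs; have [ic _] := cauchy_integral hs.
rewrite (int_nrm iq); congr EFin.
have ni := integ_nrm ic.
under eq_rint do rewrite quadC nrmM nrm_cexp ReN.
rewrite rintZ; last exact: (integ_affine (- (S r * ce r)) (S_neq0 r) ni).
rewrite -mulrA; congr (_ * _).
rewrite (rint_affine (- (S r * ce r)) (S_neq0 r) (integ_meas ni)) [RHS]mulrA.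
rewrite ger0_norm ?expR_ge0// /S -[expR _ * expR (softplus r - _ - _)]expRD.
have -> : lv + r / 2 - softplus r + (softplus r - r / 2 - lv) = 0 by ring.
by rewrite expR0 mul1r.
Qed.

(* Integrating over [r] turns the last factor into [Gamma(a) Gamma(b) / Gamma(a + b)] by translation invariance. *)
Let feynman a b x r : x != 0 -> v - x != 0 ->
  cexp b r * cexp (- (a + b)) (ln_quad r x) =
  normpow2 a x * normpow2 b (v - x) * beta_kernel a b (r + (ln ((v - x) ^+ 2) - ln (x ^+ 2))).
Proof.
move=> x0 vx0; rewrite !normpow2E !neq0_ind_eq1// !mul1r.
have -> : ln_quad r x = ln (x ^+ 2) + softplus (r + (ln ((v - x) ^+ 2) - ln (x ^+ 2))).
  apply: expR_inj; rewrite expRD expR_softplus !lnK ?posrE ?sqr_gt0// expRD expRB.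
  rewrite !lnK ?posrE ?sqr_gt0//; field; exact: x0.
rewrite /beta_kernel !cexpDr cexpNr; set l := cexp _ (softplus _).
rewrite opprD !cexpDl cexpN [cexp (- b) _]cexpN [cexp (- b) (ln (x ^+ 2))]cexpN.
by field; rewrite !cexp_neq0.
Qed.

(** [Re a < 1/2] and [Re b < 1/2] give local integrability of [|x|^(-2a)] at [0] and of
    [|v-x|^(-2b)] at [v], and the bound on the sum gives integrability at infinity. Positivity is
    what the Beta integral asks for. *)
Variables a b : C.
Hypotheses (a0 : 0 < Re a) (a1 : Re a < 1 / 2) (b0 : 0 < Re b) (b1 : Re b < 1 / 2)
  (ab : 1 / 2 < Re a + Re b).

Let s := a + b.
Let hs : 1 / 2 < Re s. Proof. by rewrite /s ReD. Qed.
Let s0 : 0 < Re s. Proof. by move: hs; lra. Qed.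

Let f x := normpow2 a x * normpow2 b (v - x).
(** Integrated over [r] first this gives [f x] times the Beta integral of [a] and [b]; integrated
    over [x] first it gives a Cauchy integral. The indicators make the first reading valid also at
    the singularities. *)
Let k x r : C := (neq0_ind x * neq0_ind (v - x))%:C * (cexp b r * cexp (- s) (ln_quad r x)).

Let cm_f : cmeas f.
Proof. by apply: cmeasM; [exact: cmeas_normpow2|apply: (cmeas_comp (cmeas_normpow2 b)); mea]. Qed.

Let cm_q : cmeas (fun z : R * R => cexp b z.2 * cexp (- s) (ln_quad z.2 z.1)).
Proof. by rewrite /ln_quad; cmea. Qed.

Let cm_k : cmeas (fun z : R * R => k z.1 z.2).
Proof.
apply: cmeasM; last exact: cm_q.
apply: cmeasR; apply: measM; first exact: (meas_comp (@meas_neq0_ind R) (@meas_fst R)).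
by apply: (meas_comp (@meas_neq0_ind R)); mea.
Qed.

Let kE x r : k x r = f x * beta_kernel a b (r + (ln ((v - x) ^+ 2) - ln (x ^+ 2))).
Proof.
rewrite /k /f; have [->|x0] := eqVneq x 0; first by rewrite normpow2E neq0_ind_eq0 mul0r !mul0r.
have [->|vx0] := eqVneq (v - x) 0; first by rewrite (normpow2E b) neq0_ind_eq0 mulr0 !mul0r mulr0 mul0r.
by rewrite !neq0_ind_eq1// mul1r mul1r feynman.
Qed.

Let a' := (1 / 2)%:C - b.
Let b' := (1 / 2)%:C - a.
Let a'0 : 0 < Re a'. Proof. by rewrite ReD ReN/= subr_gt0. Qed.
Let b'0 : 0 < Re b'. Proof. by rewrite ReD ReN/= subr_gt0. Qed.

(** What the [x]-integral leaves is again a Beta integrand: the exponents of [e^r] add up to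
    [b - s + 1/2 = b'], those of [1 + e^r] to [s - 1 = - (a' + b')], and the remaining power of
    [|v|] is [1 - 2 s]. *)
Let outer r : cexp b r * (cexp (- s) (lD r) * (expR (lv + r / 2 - softplus r))%:C) =
  cexp (1 - 2 * s) lv * beta_kernel a' b' r.
Proof.
have half : (1 / 2)%:C = 1 / 2 :> C.
  by rewrite rmorphM/= rmorph1 mul1r fmorphV/= rmorph_nat mul1r.
have e1 : cexp (- s) (lD r) = cexp (- s) lv * cexp (- s) lv * cexp (- s) r * cexp s (softplus r).
  have -> : lD r = lv + lv + r + - softplus r by rewrite /lD; ring.
  by rewrite !cexpDr cexpNr opprK.
have e2 : (expR (lv + r / 2 - softplus r))%:C = cexp 1 lv * cexp (1 / 2)%:C r * cexp (-1) (softplus r).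
  have -> : lv + r / 2 - softplus r = lv + (1 / 2) * r + - softplus r by field.
  by rewrite -cexp1 !cexpDr cexpNr cexpMr mulr1.
have e3 : beta_kernel a' b' r = (cexp b r * cexp (- s) r * cexp (1 / 2)%:C r) *
    (cexp s (softplus r) * cexp (-1) (softplus r)).
  rewrite /beta_kernel -!cexpDl; congr (cexp _ _ * cexp _ _); rewrite /a' /b' /s ?half; first by ring.
  by field.
have e4 : cexp (1 - 2 * s) lv = cexp (- s) lv * cexp (- s) lv * cexp 1 lv.
  by rewrite -!cexpDl; congr cexp; ring.
by rewrite e1 e2 e3 e4; ring.
Qed.

(** With the indicators bounded by 1 and the [x]-integral taken first, [outer] in modulus reduces
    the claim to integrability of [beta_kernel a' b']. *)
Let finite : (\int[mu]_x \int[mu]_r (nrm (k x r))%:E < +oo)%E.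
Proof.
have mq : measurable_fun setT (fun z : R * R => nrm (cexp b z.2 * cexp (- s) (ln_quad z.2 z.1))).
  exact: meas_nrm cm_q.
apply: (@le_lt_trans _ _ (\int[mu]_x \int[mu]_r (nrm (cexp b r * cexp (- s) (ln_quad r x)))%:E)%E).
  apply: le_iint => // [|x r|x r]; first exact: meas_nrm cm_k.
    exact: nrm_ge0.
  rewrite /k nrmM nrmR ger0_norm ?mulr_ge0 ?neq0_ind_ge0// ler_piMl ?nrm_ge0//.
  by rewrite mulr_ile1 ?neq0_ind_ge0 ?neq0_ind_le1.
rewrite tonelli; first last.
- by move=> x r; rewrite lee_fin nrm_ge0.
- by apply/measurable_EFinP.
have [ic _] := cauchy_integral hs.
have ib := integ_nrm (cinteg_beta_kernel a'0 b'0).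
have E r : (\int[mu]_x (nrm (cexp b r * cexp (- s) (ln_quad r x)))%:E =
   ((nrm (cexp (1 - 2 * s) lv) * rint (fun x => nrm (cauchy_kernel s x))) * nrm (beta_kernel a' b' r))%:E)%E.
  transitivity ((nrm (cexp b r))%:E * \int[mu]_x (nrm (cexp (- s) (ln_quad r x)))%:E)%E.
    rewrite -ge0_integralZl//.
    + by apply: eq_integral => x _; rewrite nrmM EFinM.
    + apply: meas_EFin; apply: meas_nrm; exact: (cinteg_cmeas (quad_int r hs).1).
    + by move=> x _; rewrite lee_fin nrm_ge0.
    + by rewrite lee_fin nrm_ge0.
  rewrite quad_nrm// -EFinM; congr EFin.
  have := congr1 (@nrm R) (outer r); rewrite !nrmM nrmR ger0_norm ?expR_ge0// [nrm (cexp (- s) _)]nrm_cexp ReN => e.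
  by rewrite [LHS]mulrA e; ring.
under eq_integral => r _ do rewrite E.
by rewrite (rintE (integZ _ ib)) ltry.
Qed.

(** By translation invariance the [r]-section of [|k|] at [x] has mass [c |f x|], so [finite]
    transfers to [f]. The mass [c] is positive because the Beta integral is a quotient of nonzero
    Gamma values. *)
Lemma cinteg_riesz : cinteg f.
Proof.
pose c := rint (fun r => nrm (beta_kernel a b r)).
have ib := cinteg_beta_kernel a0 b0.
have c0 : 0 < c.
  have h := beta_integral a0 b0.
  have n0 : cRint (beta_kernel a b) != 0.
    apply/eqP => z; move: h; rewrite z mulr0 => /esym/eqP.
    by rewrite mulf_eq0 !(negPf (eGamma_neq0 _)).
  have := nrm_cRint ib; have := nrm_gt0 n0; rewrite -/c; lra.
apply: (@cinteg_of_iint _ k _ c _ _ _ finite) => //.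
move=> x; under eq_integral do rewrite kE nrmM.
rewrite (@int_shift _ (fun p => nrm (f x) * nrm (beta_kernel a b p))).
- by rewrite (rintE (integZ _ (integ_nrm ib))) rintZ 1?mulrC//; exact: integ_nrm.
- by apply: measM; [exact: meas_cst|apply: integ_meas; exact: integ_nrm].
- by move=> y; rewrite mulr_ge0 ?nrm_ge0.
Qed.

Lemma riesz_integral : cRint f = (Num.sqrt pi)%:C * cexp (1 - 2 * s) lv *
  (eGamma ((1 / 2)%:C - a) * eGamma ((1 / 2)%:C - b) * eGamma (s - (1 / 2)%:C)
   / (eGamma a * eGamma b * eGamma (1 - s))).
Proof.
have ib := cinteg_beta_kernel a0 b0; have ib' := cinteg_beta_kernel a'0 b'0.
have [ic hc] := cauchy_integral hs.
have s1 : 1 - s = a' + b'.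
  rewrite /a' /b' /s.
  have -> : (1 / 2)%:C = 1 / 2 :> C by rewrite rmorphM/= rmorph1 mul1r fmorphV/= rmorph_nat mul1r.
  by field.
have s10 : 0 < Re (1 - s) by rewrite s1 ReD addr_gt0.
have h : cRint f * cRint (beta_kernel a b) =
    cexp (1 - 2 * s) lv * cRint (cauchy_kernel s) * cRint (beta_kernel a' b').
  transitivity (cRint (fun x => cRint (k x))).
    rewrite mulrC -cRintZ ?cinteg_riesz//; last exact: cinteg_riesz.
    apply: eq_cRint => x; rewrite mulrC -(cRint_shiftZ (f x) (ln ((v - x) ^+ 2) - ln (x ^+ 2)) ib).
    by apply: eq_cRint => r; rewrite kE.
  rewrite (cfubini cm_k finite) -cRintZ//; apply: eq_cRint => r.
  rewrite -[LHS]/(cRint (fun x => k x r)).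
  have [iq eq] := quad_int r hs.
  transitivity (cRint (fun x => cexp b r * cexp (- s) (ln_quad r x))).
    (* The indicators in [k] differ from 1 only at the two singularities. *)
    apply: (@cRint_off2 R _ _ 0 v).
    - apply: (cmeas_section cm_k).
    - exact: (cinteg_cmeas (cintegZ _ iq)).
    - by move=> x x0 xv; rewrite /k !neq0_ind_eq1 ?mul1r// subr_eq0 eq_sym.
  rewrite cRintZ// eq mulrA outer; ring.
have B1 := beta_integral a0 b0; have B2 := beta_integral a'0 b'0.
rewrite -s1 -/a' -/b' in B2 *.
have n1 := eGamma_neq0 a0; have n2 := eGamma_neq0 b0; have n3 := eGamma_neq0 s10; have n4 := eGamma_neq0 s0.
(* Multiplying by [eGamma s] and by [eGamma a * eGamma b] lets [B1] bring in the Beta integral next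
   to [cRint f], the product that [h] evaluates. *)
apply: (mulIf n4); apply: (mulIf (mulf_neq0 n1 n2)).
rewrite -[in LHS]B1 -/s.
have -> : cRint f * eGamma s * (eGamma s * cRint (beta_kernel a b)) =
   eGamma s * eGamma s * (cRint f * cRint (beta_kernel a b)) by ring.
rewrite h.
have -> : eGamma s * eGamma s * (cexp (1 - 2 * s) lv * cRint (cauchy_kernel s) * cRint (beta_kernel a' b')) =
  cexp (1 - 2 * s) lv * (eGamma s * cRint (cauchy_kernel s)) * eGamma s * (eGamma (1 - s) * cRint (beta_kernel a' b')) / eGamma (1 - s).
  by field.
rewrite hc B2; field.
by rewrite n1 n2 n3.
Qed.
End Riesz.

(** * Mellin-Barnes form of the convolution *)

Section ConvolutionMellin.
Variable R : realType.
Local Notation C := R[i].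
Local Notation Re := complex.Re.
Local Notation Im := complex.Im.
Notation mu := (@lebesgue_measure R).
Local Open Scope complex_scope.

(** With [L = ln Lambda] this is [exp(-(Lambda |x|)^a)] off the origin. The value 0 at the origin
    matches that of [normpow2], so that the inversion formula holds at every [x]. *)
Definition ggd_kernel (a L x : R) : R := neq0_ind x * expNexp (a * (L + ln `|x|)).

Definition ggd_mellin (a L c t : R) : C :=
  eGamma ((1 / a)%:C + (2 / a)%:C * (c +i* t)) * cexp (- (1 + 2 * (c +i* t))) L.

(** The exponent for which [normpow2] becomes [|x|^(-1-2s)], where [s = c + i t]. *)
Definition half_line (c t : R) : C := (1 / 2)%:C + (c +i* t).

Lemma meas_ggd_kernel (a L : R) : meas (ggd_kernel a L).
Proof.
apply: measM; first exact: meas_neq0_ind.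
by apply: (meas_comp (@meas_expNexp R)); mea.
Qed.

Lemma ggd_kernel_ge0 (a L x : R) : 0 <= ggd_kernel a L x.
Proof. by rewrite mulr_ge0 ?neq0_ind_ge0// expR_ge0. Qed.

Lemma nrm_normpow2 (a b : C) (x : R) : Re a = Re b -> nrm (normpow2 a x) = nrm (normpow2 b x).
Proof. by move=> ab; rewrite !normpow2E !nrmM !nrm_cexp !ReN ab. Qed.

Lemma Re_half_line (c t : R) : Re (half_line c t) = 1 / 2 + c. Proof. by []. Qed.

Lemma half_line_bounds (c1 c2 t u : R) : - (1 / 2) < c1 -> - (1 / 2) < c2 -> c1 < 0 -> c2 < 0 ->
  - (1 / 2) < c1 + c2 ->
  [/\ 0 < Re (half_line c1 t), Re (half_line c1 t) < 1 / 2, 0 < Re (half_line c2 u),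
  Re (half_line c2 u) < 1 / 2 & 1 / 2 < Re (half_line c1 t) + Re (half_line c2 u)].
Proof. by move=> *; rewrite !Re_half_line; split; lra. Qed.

Lemma cinteg_ggd_mellin (a L c : R) : 0 < a -> - (1 / 2) < c -> cinteg (ggd_mellin a L c).
Proof.
move=> a0 hc; pose d := (1 + 2 * c) / a.
have d0 : 0 < d by rewrite divr_gt0//; lra.
have a1 : a != 0 by rewrite gt_eqF.
have h : 2 / a != 0 by rewrite mulf_neq0// invr_eq0.
have [K [K0 hK]] := eGamma_decay d0.
have e t : eGamma ((1 / a)%:C + (2 / a)%:C * (c +i* t)) = eGamma (d +i* (2 / a * t + 0)).
  by congr eGamma; apply: cext; rewrite !ReImE/= /d; field.
have i0 := integZ (K * expR (- (1 + 2 * c) * L)) (integ_affine 0 h (@integ_inv1Dsqr R)).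
apply: (cinteg_le _ i0) => [|t].
  apply: cmeasM; last by cmea.
  under eq_fun do rewrite e.
  by apply: (cmeas_comp (cmeas_eGamma d0)); mea.
have hr : Re (- (1 + 2 * (c +i* t))) = - (1 + 2 * c) by rewrite !ReImE/=; ring.
rewrite nrmM nrm_cexp e hr [leRHS]mulrAC.
by rewrite ler_wpM2r ?expR_ge0.
Qed.

Lemma cmeas_half_line_normpow2 (c : R) : cmeas (fun z : R * R => normpow2 (half_line c z.2) z.1).
Proof.
under eq_fun do rewrite normpow2E.
apply: cmeasM; first by apply: cmeasR; exact: (meas_comp (@meas_neq0_ind R) (@meas_fst R)).
by rewrite /half_line; cmea.
Qed.

Section Kernel.
Variables a L c : R.
Hypotheses (a0 : 0 < a) (hc : - (1 / 2) < c).

Lemma cmeas_ggd_mellin_snd : cmeas (fun z : R * R => ggd_mellin a L c z.2).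
Proof. exact: (cmeas_comp (cinteg_cmeas (cinteg_ggd_mellin L a0 hc)) (@meas_snd R)). Qed.

Lemma cinteg_ggd_mellin_normpow2 x : cinteg (fun t => ggd_mellin a L c t * normpow2 (half_line c t) x).
Proof.
have iH := cinteg_ggd_mellin L a0 hc.
apply: (cinteg_le _ (integZ (nrm (normpow2 (half_line c 0) x)) (integ_nrm iH))) => [|t].
  apply: cmeasM; first exact: cinteg_cmeas.
  by under eq_fun do rewrite normpow2E; apply: cmeasM; [exact: cmeas_cst|rewrite /half_line; cmea].
by rewrite nrmM mulrC (@nrm_normpow2 _ (half_line c 0)).
Qed.

Lemma ggd_kernel_mellin x : cRint (fun t => ggd_mellin a L c t * normpow2 (half_line c t) x) = (a * pi * ggd_kernel a L x)%:C.
Proof.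
have [->|x0] := eqVneq x 0.
  rewrite /ggd_kernel neq0_ind_eq0 mul0r mulr0; transitivity (cRint (fun _ : R => (0 : R)%:C)).
    by apply: eq_cRint => t; rewrite normpow2E neq0_ind_eq0 !mul0r mulr0.
  by rewrite cRint_real /rint /Rintegral integral0.
rewrite /ggd_kernel neq0_ind_eq1// mul1r -(expNexp_mellin (L + ln `|x|) a0 hc).
apply: eq_cRint => t; rewrite /ggd_mellin normpow2E neq0_ind_eq1// [1%:C * _]mul1r -mulrA cexpDr; congr (_ * (_ * _)).
have -> : ln (x ^+ 2) = 2 * ln `|x|.
  by rewrite -[x ^+ 2]real_normK ?num_real// lnXn ?normr_gt0// mulr_natl.
rewrite cexpMr; congr (cexp _ _); rewrite /half_line.
have -> : (1 / 2)%:C = 1 / 2 :> C.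
  by rewrite rmorphM/= rmorph1 mul1r fmorphV/= rmorph_nat mul1r.
by rewrite rmorph_nat; field.
Qed.

(** Moduli taken inside the inversion formula give [|x|^(-1-2c)] times a constant. This is how
    products of kernels come to be dominated by integrable Riesz integrands. *)
Lemma ggd_kernel_bound : exists K, 0 <= K /\ forall x, ggd_kernel a L x <= K * nrm (normpow2 (half_line c 0) x).
Proof.
have iH := cinteg_ggd_mellin L a0 hc.
have ap : 0 < a * pi by rewrite mulr_gt0 ?pi_gt0.
exists ((a * pi)^-1 * (2 * rint (fun t => nrm (ggd_mellin a L c t)))); split.
  by rewrite mulr_ge0 ?invr_ge0 ?(ltW ap)// mulr_ge0// rint_ge0// => t; exact: nrm_ge0.
move=> x; rewrite -mulrA ler_pdivlMl//.
have := nrm_cRint (cinteg_ggd_mellin_normpow2 x); rewrite ggd_kernel_mellin nrmR ger0_norm; last first.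
  by rewrite mulr_ge0 ?(ltW ap)// ggd_kernel_ge0.
move=> /le_trans; apply; rewrite -mulrA ler_pM2l// mulrC -rintZ; last exact: integ_nrm.
apply: le_rint => [||t]; [exact/integ_nrm/cinteg_ggd_mellin_normpow2|exact/integZ/integ_nrm|].
by rewrite nrmM mulrC (@nrm_normpow2 _ (half_line c 0)).
Qed.
End Kernel.

Variables a b L1 L2 c1 c2 v : R.
Hypotheses (a0 : 0 < a) (b0 : 0 < b) (hc1 : - (1 / 2) < c1) (hc2 : - (1 / 2) < c2)
  (hc1' : c1 < 0) (hc2' : c2 < 0) (hc : - (1 / 2) < c1 + c2) (v0 : v != 0).

Let H1 := ggd_mellin a L1 c1.
Let H2 := ggd_mellin b L2 c2.
Let iH1 : cinteg H1. Proof. exact: cinteg_ggd_mellin. Qed.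
Let iH2 : cinteg H2. Proof. exact: cinteg_ggd_mellin. Qed.

Let hypsR (t u : R) : [/\ 0 < Re (half_line c1 t), Re (half_line c1 t) < 1 / 2, 0 < Re (half_line c2 u),
  Re (half_line c2 u) < 1 / 2 & 1 / 2 < Re (half_line c1 t) + Re (half_line c2 u)].
Proof. exact: half_line_bounds. Qed.

Let rz t u := cRint (fun x => normpow2 (half_line c1 t) x * normpow2 (half_line c2 u) (v - x)).

Let inormpow2 t u : cinteg (fun x => normpow2 (half_line c1 t) x * normpow2 (half_line c2 u) (v - x)).
Proof. by have [h1 h2 h3 h4 h5] := hypsR t u; exact: cinteg_riesz. Qed.

(** The modulus of the Riesz integrand is the same at all heights [t] and [u], so the value at
    height 0 is a common majorant. *)
Let N x := nrm (normpow2 (half_line c1 0) x * normpow2 (half_line c2 0) (v - x)).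
Let iN : integ N. Proof. exact: integ_nrm (inormpow2 0 0). Qed.

Let G1 := ggd_kernel a L1.
Let G2 x := ggd_kernel b L2 (v - x).
Let mG2 : meas G2.
Proof. by apply: (meas_comp (meas_ggd_kernel b L2)); mea. Qed.

Lemma integ_ggd_kernel_conv : integ (fun x => ggd_kernel a L1 x * ggd_kernel b L2 (v - x)).
Proof.
have [K1 [K10 hK1]] := ggd_kernel_bound L1 a0 hc1; have [K2 [K20 hK2]] := ggd_kernel_bound L2 b0 hc2.
apply: (integ_le _ (integZ (K1 * K2) iN)) => [|x].
  by apply: measM; [exact: meas_ggd_kernel|exact: mG2].
rewrite ger0_norm; last by rewrite mulr_ge0// ggd_kernel_ge0.
rewrite /N nrmM.
have -> (A B : R) : K1 * K2 * (A * B) = (K1 * A) * (K2 * B) by ring.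
apply: ler_pM; [exact: ggd_kernel_ge0|exact: ggd_kernel_ge0|exact: hK1|exact: hK2].
Qed.

Let inner (z : C) t : cRint (fun x => z * normpow2 (half_line c1 t) x * (b * pi * G2 x)%:C) =
  cRint (fun u => z * H2 u * rz t u).
Proof.
pose k x u := (z * normpow2 (half_line c1 t) x) * (H2 u * normpow2 (half_line c2 u) (v - x)).
transitivity (cRint (fun x => cRint (k x))).
  apply: eq_cRint => x; rewrite /G2 -(ggd_kernel_mellin L2 b0 hc2).
  by rewrite -cRintZ//; exact: cinteg_ggd_mellin_normpow2.
have cmk : cmeas (fun w : R * R => k w.1 w.2).
  apply: cmeasM; first by apply: cmeasM; [exact: cmeas_cst|exact: (cmeas_comp (cmeas_normpow2 _) (@meas_fst R))].
  apply: cmeasM; first exact: cmeas_ggd_mellin_snd.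
  under eq_fun do rewrite normpow2E.
  apply: cmeasM; first by apply: cmeasR; apply: (meas_comp (@meas_neq0_ind R)); mea.
  by rewrite /half_line; cmea.
rewrite (cfubini cmk).
  apply: eq_cRint => u; rewrite /rz -cRintZ//.
  by apply: eq_cRint => x; rewrite /k; ring.
apply: le_lt_trans (iint_prod (integZ (nrm z) iN) (integ_nrm iH2)).
apply: le_iint => [|||x u].
- exact: meas_nrm cmk.
- apply: measM; last exact: (meas_comp (integ_meas (integ_nrm iH2)) (@meas_snd R)).
  by apply: measM; [exact: meas_cst|exact: (meas_comp (integ_meas iN) (@meas_fst R))].
- by move=> x u; exact: nrm_ge0.
- rewrite /k /N !nrmM (@nrm_normpow2 (half_line c1 t) (half_line c1 0))// (@nrm_normpow2 (half_line c2 u) (half_line c2 0))//.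
  by rewrite le_eqVlt; apply/orP; left; apply/eqP; ring.
Qed.

(** The two kernels are expanded one after the other, so that each exchange involves two variables
    only: [x] with [t] here, the second kernel being kept and bounded by [ggd_kernel_bound], then
    [x] with [u] in [inner]. The majorants are [N x] times [|H1 t|] or [|H2 u|]. *)
Lemma convolution_mellin (z : C) :
  z * (a * pi * (b * pi) * rint (fun x => ggd_kernel a L1 x * ggd_kernel b L2 (v - x)))%:C =
  cRint (fun t => cRint (fun u => z * ggd_mellin a L1 c1 t * ggd_mellin b L2 c2 u *
    cRint (fun x => normpow2 (half_line c1 t) x * normpow2 (half_line c2 u) (v - x)))).
Proof.
pose k x t := (z * H1 t) * normpow2 (half_line c1 t) x * (b * pi * G2 x)%:C.
transitivity (cRint (fun x => cRint (k x))).
  have e x : cRint (k x) = z * (a * pi * (b * pi) * (G1 x * G2 x))%:C.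
    transitivity (cRint (fun t => z * (b * pi * G2 x)%:C * (H1 t * normpow2 (half_line c1 t) x))).
      by apply: eq_cRint => t; rewrite /k; ring.
    rewrite cRintZ; last exact: cinteg_ggd_mellin_normpow2.
    by rewrite /H1 ggd_kernel_mellin// -mulrA -rmorphM/= /G1; congr (_ * _%:C); ring.
  under [RHS]eq_cRint do rewrite e.
  have iG := integ_ggd_kernel_conv.
  rewrite cRintZ; last first.
    split => /=; first exact: integZ.
    by apply: (@integ_dom R 0) => [|y]; [exact: meas_cst|rewrite mul0r normr0].
  by rewrite cRint_real rintZ.
have cmk : cmeas (fun w : R * R => k w.1 w.2).
  apply: cmeasM; last by apply: cmeasR; apply: measM; [exact: meas_cst|exact: (meas_comp mG2 (@meas_fst R))].
  apply: cmeasM; last exact: cmeas_half_line_normpow2.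
  by apply: cmeasM; [exact: cmeas_cst|exact: cmeas_ggd_mellin_snd].
rewrite (cfubini cmk).
  by apply: eq_cRint => t; exact: inner.
have [K2 [K20 hK2]] := ggd_kernel_bound L2 b0 hc2.
have bp : 0 <= b * pi by rewrite mulr_ge0 ?(ltW b0)// ltW// pi_gt0.
apply: le_lt_trans (iint_prod (integZ (nrm z * (b * pi * K2)) iN) (integ_nrm iH1)).
apply: le_iint => [|||x t].
- exact: meas_nrm cmk.
- apply: measM; last exact: (meas_comp (integ_meas (integ_nrm iH1)) (@meas_snd R)).
  by apply: measM; [exact: meas_cst|exact: (meas_comp (integ_meas iN) (@meas_fst R))].
- by move=> x t; exact: nrm_ge0.
- have G20 : 0 <= b * pi * G2 x by rewrite mulr_ge0// ggd_kernel_ge0.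
  rewrite /k (nrmM _ (b * pi * G2 x)%:C) (nrmM (z * H1 t)) (nrmM z).
  rewrite (@nrm_normpow2 (half_line c1 t) (half_line c1 0))// nrmR ger0_norm// /N (nrmM (normpow2 _ x)).
  have h : b * pi * G2 x <= b * pi * (K2 * nrm (normpow2 (half_line c2 0) (v - x))).
    by apply: ler_wpM2l => //; exact: hK2.
  apply: (@le_trans _ _ (nrm z * nrm (H1 t) * nrm (normpow2 (half_line c1 0) x) *
     (b * pi * (K2 * nrm (normpow2 (half_line c2 0) (v - x)))))).
    by apply: ler_wpM2l h; rewrite !mulr_ge0 ?nrm_ge0.
  by rewrite le_eqVlt; apply/orP; left; apply/eqP; ring.
Qed.
End ConvolutionMellin.

(** * Density of a sum of independent variables *)

Section SumDensity.
Context d (T : measurableType d) (R : realType) (P : probability T R).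
Notation mu := (@lebesgue_measure R).
Variables (X Y : {RV P >-> R}) (f g : R -> R) (M : R).
Hypotheses (mf : meas f) (mg : meas g) (f0 : forall x, 0 <= f x) (g0 : forall x, 0 <= g x)
  (gM : forall x, g x <= M).
Hypotheses (hX : has_density P X f) (hY : has_density P Y g) (hXY : indep_RV P X Y).

Lemma integ_density (Z : {RV P >-> R}) (h : R -> R) : meas h -> (forall x, 0 <= h x) ->
  has_density P Z h -> integ h.
Proof.
move=> mh h0 hZ; apply/integ_ge0P => //.
by have := hZ setT measurableT; rewrite preimage_setT probability_setT => <-; rewrite ltry.
Qed.

Let fi : integ f. Proof. exact: integ_density hX. Qed.
Let gi : integ g. Proof. exact: integ_density hY. Qed.

Let R2 := (measurableTypeR R * measurableTypeR R)%type.
Let F (z : R2) : \bar R := (f z.1 * g z.2)%:E.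

Let mF : measurable_fun setT F.
Proof.
apply/measurable_EFinP; apply: measM.
- exact: (meas_comp mf (@meas_fst R)).
- exact: (meas_comp mg (@meas_snd R)).
Qed.

Let F0 z : (0 <= F z)%E. Proof. by rewrite lee_fin mulr_ge0. Qed.

(** The measure on the plane with density [f(x) g(y)], made a measure structure so that uniqueness
    of product measures applies to it. *)
Let nu (E : set R2) : \bar R := (\int[mu \x mu]_(z in E) F z)%E.

Let nu_set0 : nu set0 = 0%E. Proof. by rewrite /nu integral_set0. Qed.
Let nu_ge0 E : (0 <= nu E)%E. Proof. by apply: integral_ge0. Qed.
Let nu_sigma : semi_sigma_additive nu.
Proof. exact: semi_sigma_additive_nng_induced. Qed.

HB.instance Definition _ := isMeasure.Build _ _ _ nu nu_set0 nu_ge0 nu_sigma.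

Let meas_ind (A : set R) : measurable A -> meas (\1_A : R -> R).
Proof. by move=> mA; exact: measurable_indic. Qed.

Let int_mkcond (A : set R) (h : R -> R) :
  (\int[mu]_(x in A) (h x)%:E = \int[mu]_x (\1_A x * h x)%:E)%E.
Proof.
rewrite integral_mkcond; apply: eq_integral => x _; rewrite patchE indicE.
by case: (x \in A); rewrite ?mul1r ?mul0r.
Qed.

Let integ_mkcond (A : set R) (h : R -> R) : measurable A -> integ h ->
  integ (fun x => \1_A x * h x).
Proof.
move=> mA hi; apply: (integ_le _ (integ_norm hi)) => [|x].
  by apply: measM; [exact: meas_ind|exact: integ_meas].
by rewrite normrM ler_piMl// indicE; case: (_ \in _); rewrite ?normr1 ?normr0.
Qed.

Let nuE (E : set R2) : measurable E ->
  nu E = (\int[mu]_x \int[mu]_y (\1_E (x, y) * (f x * g y))%:E)%E.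
Proof.
move=> mE; rewrite /nu integral_mkcond.
have e : F \_ E = fun z => (\1_E z * (f z.1 * g z.2))%:E.
  apply/funext => z; rewrite patchE indicE /F.
  by case: (z \in E); rewrite ?mul1r ?mul0r.
rewrite e.
have m1 : measurable_fun setT (fun z : R2 => (\1_E z * (f z.1 * g z.2))%:E).
  apply/measurable_EFinP; apply: measurable_funM; first exact: measurable_indic.
  by move/measurable_EFinP : mF.
rewrite (@fubini_tonelli1 _ _ _ _ R mu mu _ m1)//.
by move=> z; rewrite lee_fin !mulr_ge0.
Qed.

Let XY (w : T) : R2 := (X w, Y w).
Let measX : measurable_fun setT (X : T -> measurableTypeR R).
Proof. exact: (measurable_funPT X). Qed.
Let mY : measurable_fun setT (Y : T -> measurableTypeR R).
Proof. exact: (measurable_funPT Y). Qed.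
Let mXY : measurable_fun setT XY.
Proof. by apply: measurable_fun_pair; [exact: measX|exact: mY]. Qed.

(** Both the law of the pair and [nu] take the product value on rectangles, the first by
    independence, the second by the two densities; hence both equal the product of the marginal
    laws. *)
Lemma joint_density (E : set R2) : measurable E -> P (XY @^-1` E) = nu E.
Proof.
move=> mE.
pose phi : {mfun T >-> R2} := HB.pack XY (isMeasurableFun.Build _ _ _ _ _ mXY).
pose X' : {mfun T >-> measurableTypeR R} :=
  HB.pack (X : T -> measurableTypeR R) (isMeasurableFun.Build _ _ _ _ _ measX).
pose Y' : {mfun T >-> measurableTypeR R} :=
  HB.pack (Y : T -> measurableTypeR R) (isMeasurableFun.Build _ _ _ _ _ mY).
have h1 : (distribution P X' \x distribution P Y')%E E = distribution P phi E.
  exact: (@product_measure_unique _ _ _ _ R (distribution P X') (distribution P Y') (distribution P phi) hXY).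
have h2 : (distribution P X' \x distribution P Y')%E E = nu E.
  apply: (@product_measure_unique _ _ _ _ R (distribution P X') (distribution P Y')) => // A B mA mB.
  rewrite -[LHS]/(nu (A `*` B)) nuE; last exact: measurableX.
  transitivity ((\int[mu]_(x in A) (f x)%:E) * (\int[mu]_(y in B) (g y)%:E))%E; last first.
    by congr (_ * _)%E; [rewrite -hX|rewrite -hY].
  have iA := integ_mkcond mA fi; have iB := integ_mkcond mB gi.
  rewrite (int_mkcond A f) (int_mkcond B g) (rintE iA) (rintE iB).
  transitivity (\int[mu]_x (rint (fun y => \1_B y * g y) * (\1_A x * f x))%:E)%E.
    apply: eq_integral => x _.
    transitivity (\int[mu]_y ((\1_A x * f x) * (\1_B y * g y))%:E)%E.
      apply: eq_integral => y _; congr EFin; rewrite !indicE in_setX/=.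
      by case: (x \in A); case: (y \in B); rewrite /= ?mul1r ?mul0r ?mulr0.
    by rewrite (rintE (integZ _ iB)) rintZ// mulrC.
  by rewrite (rintE (integZ _ iA)) rintZ// EFinM muleC.
by rewrite -h2 h1.
Qed.

Lemma has_density_add : has_density P (fun w => X w + Y w)
  (fun z => rint (fun x => f x * g (z - x))).
Proof.
move=> A mA.
pose E : set R2 := [set z | A (z.1 + z.2)].
have madd : measurable_fun setT (fun z : R2 => (z.1 + z.2)%R : measurableTypeR R).
  by apply: (@measD _ R2 R); [exact: meas_fst|exact: meas_snd].
have mE : measurable E by rewrite -[E]setTI; exact: madd.
rewrite -[LHS]/(P (XY @^-1` E)) joint_density// nuE//.
(* The bound [M] makes the convolution integral converge at every [z], not merely at almost every
   one. *)
have iz z : integ (fun x => f x * g (z - x)).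
  apply: (integ_le _ (integZ M fi)) => [|x].
    by apply: measM => //; apply: (meas_comp mg); mea.
  by rewrite ger0_norm ?mulr_ge0// mulrC ler_wpM2r.
transitivity (\int[mu]_x \int[mu]_z (\1_A z * (f x * g (z - x)))%:E)%E.
  apply: eq_integral => x _.
  rewrite -(@int_shift R (fun z => \1_A z * (f x * g (z - x))) x).
  - apply: eq_integral => y _; congr EFin; rewrite addrK [y + x]addrC; congr (_ * _).
  - apply: measM; first exact: meas_ind.
    by apply: measM; [exact: meas_cst|apply: (meas_comp mg); mea].
  - by move=> y; rewrite !mulr_ge0.
rewrite tonelli; first last.
- by move=> x y; rewrite lee_fin !mulr_ge0.
- apply/measurable_EFinP; apply: measM; first exact: (meas_comp (meas_ind mA) (@meas_snd R)).
  by apply: measM; [exact: (meas_comp mf (@meas_fst R))|apply: (meas_comp mg); mea].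
rewrite int_mkcond; apply: eq_integral => z _.
by rewrite (rintE (integZ _ (iz z))) rintZ.
Qed.
End SumDensity.

(** * Generalized Gaussian distributions *)

Section GGD.
Variable R : realType.
Local Notation C := R[i].
Local Notation Re := complex.Re.
Local Notation Im := complex.Im.
Implicit Types a L mu v : R.
Local Open Scope complex_scope.

Lemma ggd_Lambda_ge0 (sigma a : R) (hsigma : 0 < sigma) (ha : 0 < a) :
  0 <= ggd_Lambda sigma a.
Proof. by rewrite mulr_ge0 ?invr_ge0 ?(ltW hsigma)// sqrtr_ge0. Qed.

Lemma Gamma_ge0 (x : R) : 0 <= Gamma x.
Proof. by apply: Rintegral_ge0 => t _; rewrite mulr_ge0 ?powR_ge0 ?expR_ge0. Qed.

Lemma has_density_neq0 d (T : measurableType d) (P : probability T R) (X : T -> R) (f : R -> R) :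
  has_density P X f -> ~ (forall x, f x = 0).
Proof.
move=> hX f0; have := hX setT measurableT; rewrite preimage_setT probability_setT.
under eq_integral do rewrite f0; rewrite integral0 => /eqP.
by rewrite onee_eq0.
Qed.

(* Otherwise the junk value [0^-1 = 0] would make the density vanish identically. *)
Lemma ggd_pos d (T : measurableType d) (P : probability T R) (X : T -> R)
    (mu sigma a : R) : 0 < sigma -> 0 < a -> has_density P X (ggd_pdf mu sigma a) ->
  [/\ 0 < Gamma (1 / a), 0 < Gamma (3 / a) & 0 < ggd_Lambda sigma a].
Proof.
move=> s0 a0 /has_density_neq0 h.
have G1 : Gamma (1 / a) != 0.
  by apply/eqP => z; apply: h => x; rewrite /ggd_pdf z mulr0 invr0 mulr0 mul0r.
have L1 : ggd_Lambda sigma a != 0.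
  by apply/eqP => z; apply: h => x; rewrite /ggd_pdf z mulr0 !mul0r.
have G3 : Gamma (3 / a) != 0.
  by apply: contra L1 => /eqP z; rewrite /ggd_Lambda z mul0r sqrtr0 mulr0.
by split; rewrite lt0r ?G1 ?G3 ?L1/=; [exact: Gamma_ge0|exact: Gamma_ge0|exact: ggd_Lambda_ge0].
Qed.

Lemma ggd_pdfE (mu sigma a x : R) : 0 < a -> 0 < ggd_Lambda sigma a -> x - mu != 0 ->
  ggd_pdf mu sigma a x =
  a * ggd_Lambda sigma a / (2 * Gamma (1 / a)) * ggd_kernel a (ln (ggd_Lambda sigma a)) (x - mu).
Proof.
move=> a0 L0 xm; rewrite /ggd_pdf /ggd_kernel neq0_ind_eq1// /expNexp [1 * expR _]mul1r; congr (_ * expR (- _)).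
rewrite /powR gt_eqF// normr_eq0 (negPf xm) -expRD; congr expR; ring.
Qed.

Lemma meas_ggd_pdf (mu sigma a : R) : meas (ggd_pdf mu sigma a).
Proof.
rewrite /meas /ggd_pdf; apply: measM; first exact: meas_cst; apply: meas_exp; apply: measN.
apply: measM; first exact: meas_cst.
apply: (meas_comp (h := fun y => y `^ a)); first exact: measurable_powR.
by mea.
Qed.

Lemma ggd_pdf_ge0 (mu sigma a x : R) : 0 < a -> 0 < sigma -> 0 <= ggd_pdf mu sigma a x.
Proof.
move=> a0 s0; rewrite /ggd_pdf mulr_ge0 ?expR_ge0// divr_ge0//.
  by rewrite mulr_ge0 ?(ltW a0)// ggd_Lambda_ge0.
by rewrite mulr_ge0 ?Gamma_ge0.
Qed.

Lemma ggd_pdf_le (mu sigma a x : R) : 0 < a -> 0 < sigma ->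
  ggd_pdf mu sigma a x <= a * ggd_Lambda sigma a / (2 * Gamma (1 / a)).
Proof.
move=> a0 s0; rewrite /ggd_pdf ler_piMr//.
  by apply: divr_ge0; rewrite mulr_ge0 ?(ltW a0) ?ggd_Lambda_ge0 ?Gamma_ge0.
by rewrite expR_le1 oppr_le0 mulr_ge0 ?powR_ge0.
Qed.

Lemma integ_ggd_kernelM (a b l1 l2 v : R) : 0 < a -> 0 < b -> v != 0 ->
  integ (fun x => ggd_kernel a l1 x * ggd_kernel b l2 (v - x)).
Proof.
move=> a0 b0 v0.
(* Integrability does not refer to a contour, so any admissible abscissa serves; [-1/8] is one, for
   both variables. *)
have [h1 h2 h3] : [/\ - (1 / 2) < - (1 / 8) :> R, - (1 / 8) < 0 :> R &
    - (1 / 2) < - (1 / 8) + - (1 / 8) :> R] by split; lra.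
exact: (integ_ggd_kernel_conv l1 l2 a0 b0 h1 h1 h2 h2 h3 v0).
Qed.

(** Translation by [mu1] centres the first density. The integrands then agree except possibly at [0]
    and [v], where [ggd_kernel] is set to 0. *)
Lemma ggd_convolution (mu1 mu2 s1 s2 a b z : R) : 0 < a -> 0 < b ->
  0 < ggd_Lambda s1 a -> 0 < ggd_Lambda s2 b -> z - (mu1 + mu2) != 0 ->
  rint (fun x => ggd_pdf mu1 s1 a x * ggd_pdf mu2 s2 b (z - x)) =
  a * ggd_Lambda s1 a / (2 * Gamma (1 / a)) * (b * ggd_Lambda s2 b / (2 * Gamma (1 / b))) *
  rint (fun x => ggd_kernel a (ln (ggd_Lambda s1 a)) x *
    ggd_kernel b (ln (ggd_Lambda s2 b)) (z - (mu1 + mu2) - x)).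
Proof.
move=> a0 b0 L1 L2; set v := z - (mu1 + mu2) => v0.
have mf : meas (fun x => ggd_pdf mu1 s1 a x * ggd_pdf mu2 s2 b (z - x)).
  by apply: measM; [exact: meas_ggd_pdf|apply: (meas_comp (meas_ggd_pdf _ _ _)); mea].
have ig l1 l2 := integ_ggd_kernelM l1 l2 a0 b0 v0.
rewrite [LHS](rint_affine mu1 (oner_neq0 R) mf) normr1 mul1r -(rintZ _ (ig _ _)).
apply: (rint_off2 (a := 0) (b := v)).
- by apply: (meas_comp mf); mea.
- by apply: measM; [exact: meas_cst|exact: (integ_meas (ig _ _))].
move=> x x0 xv.
have ex : 1 * x + mu1 - mu1 = x by rewrite mul1r addrK.
have ez : z - (1 * x + mu1) - mu2 = v - x by rewrite /v; ring.
have vx : v - x != 0 by rewrite subr_eq0 eq_sym.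
rewrite !ggd_pdfE ?ex ?ez//.
exact: mulrACA.
Qed.

(** The arguments of [G0] are [(Lambda |v|)^(-2)], so their powers of order [s] and [u] absorb
    everything but one factor each of the two [Lambda] and of [|v|], which the leading exponential
    compensates. *)
Lemma G0_exponents (s u : C) L1 L2 lv : (expR (L1 + L2 + lv))%:C *
  cexp (- (1 + 2 * s)) L1 * cexp (- (1 + 2 * u)) L2 * cexp (- (1 + 2 * s + 2 * u)) lv =
  cexp s (- (2 * (L1 + lv))) * cexp u (- (2 * (L2 + lv))).
Proof.
have two : 2%:C = 2 :> C by rewrite rmorph_nat.
rewrite -cexp1 !cexpNr !cexpMr two !cexpDr.
have e1 : cexp (2 * - s) L1 = cexp 1 L1 * cexp (- (1 + 2 * s)) L1.
  by rewrite -cexpDl; congr (cexp _ _); ring.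
have e2 : cexp (2 * - u) L2 = cexp 1 L2 * cexp (- (1 + 2 * u)) L2.
  by rewrite -cexpDl; congr (cexp _ _); ring.
have e3 : cexp (2 * - s) lv * cexp (2 * - u) lv = cexp 1 lv * cexp (- (1 + 2 * s + 2 * u)) lv.
  by rewrite -!cexpDl; congr (cexp _ _); ring.
rewrite e1 e2 [RHS]mulrACA [cexp _ lv * cexp _ lv]e3; ring.
Qed.

Lemma G0_integrandE a b L1 L2 c1 c2 v x y t u : 0 < a -> 0 < b ->
  - (1 / 2) < c1 -> - (1 / 2) < c2 -> c1 < 0 -> c2 < 0 -> - (1 / 2) < c1 + c2 -> v != 0 ->
  ln x = - (2 * (L1 + ln `|v|)) -> ln y = - (2 * (L2 + ln `|v|)) ->
  (expR (L1 + L2 + ln `|v|) / Num.sqrt pi)%:C * ggd_mellin a L1 c1 t * ggd_mellin b L2 c2 u *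
    cRint (fun x => normpow2 (half_line c1 t) x * normpow2 (half_line c2 u) (v - x)) =
  G0_integrand a b x y (c1 +i* t) (c2 +i* u).
Proof.
move=> a0 b0 h1 h2 h3 h4 h5 v0 lx ly.
have [r1 r2 r3 r4 r5] := half_line_bounds t u h1 h2 h3 h4 h5.
rewrite riesz_integral//.
have half : (1 / 2)%:C = 1 / 2 :> C.
  by rewrite rmorphM/= rmorph1 mul1r fmorphV/= rmorph_nat mul1r.
(* At [a = 1/2 + s], [b = 1/2 + u] the Riesz quotient becomes [Gamma(-s) Gamma(-u) Gamma(1/2+s+u)]
   over [Gamma(1/2+s) Gamma(1/2+u) Gamma(-s-u)]: all of the kernel except the two factors already in
   [ggd_mellin]. *)
rewrite /half_line; set s := c1 +i* t; set w := c2 +i* u.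
have e1 : (1 / 2)%:C - ((1 / 2)%:C + s) = - s by ring.
have e2 : (1 / 2)%:C - ((1 / 2)%:C + w) = - w by ring.
have e3 : (1 / 2)%:C + s + ((1 / 2)%:C + w) - (1 / 2)%:C = (1 / 2)%:C + s + w by ring.
have e4 : 1 - ((1 / 2)%:C + s + ((1 / 2)%:C + w)) = - s - w by rewrite half; field.
have e5 : 1 - 2 * ((1 / 2)%:C + s + ((1 / 2)%:C + w)) = - (1 + 2 * s + 2 * w).
  by rewrite half; field.
rewrite e1 e2 e3 e4 e5 /G0_integrand /theta !cpowE lx ly.
have p1 : 0 < Re ((1 / 2)%:C + s + w) by rewrite !ReD/=; lra.
have p2 : 0 < Re (- s - w) by rewrite !ReImE/=; lra.
have p3 : 0 < Re (- s) by rewrite ReN/=; lra.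
have p4 : 0 < Re (- w) by rewrite ReN/=; lra.
have p5 : 0 < Re ((1 / 2)%:C + s) by rewrite ReD/=; lra.
have p6 : 0 < Re ((1 / 2)%:C + w) by rewrite ReD/=; lra.
have p7 : 0 < Re ((1 / a)%:C + (2 / a)%:C * s).
  have -> : Re ((1 / a)%:C + (2 / a)%:C * s) = (1 + 2 * c1) / a by rewrite !ReImE/=; field; rewrite gt_eqF.
  by rewrite divr_gt0//; lra.
have p8 : 0 < Re ((1 / b)%:C + (2 / b)%:C * w).
  have -> : Re ((1 / b)%:C + (2 / b)%:C * w) = (1 + 2 * c2) / b by rewrite !ReImE/=; field; rewrite gt_eqF.
  by rewrite divr_gt0//; lra.
rewrite !cGammaE// -[RHS]mulrA -G0_exponents /ggd_mellin -/s -/w.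
have n1 := eGamma_neq0 p5; have n2 := eGamma_neq0 p6; have n3 := eGamma_neq0 p2.
have n4 : (Num.sqrt pi)%:C != 0 :> C.
  by apply/eqP => /complexI/eqP; rewrite gt_eqF// sqrtr_gt0 pi_gt0.
rewrite rmorphM/= fmorphV/=; field.
by rewrite n1 n2 n3 n4.
Qed.

Lemma expR_lnD3 (x y z : R) : 0 < x -> 0 < y -> 0 < z ->
  expR (ln x + ln y + ln z) = x * y * z.
Proof. by move=> x0 y0 z0; rewrite !expRD !lnK. Qed.

Lemma ln_sqrM (x y : R) : 0 < x -> 0 < y -> 2 * (ln x + ln y) = ln ((x * y) ^+ 2).
Proof. by move=> x0 y0; rewrite lnXn ?mulr_gt0// lnM ?posrE// mulr_natl. Qed.

(** [A], [B] stand for the two [ggd_Lambda], [G], [H] for the values of [Gamma] at [1/alpha],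
    [1/beta], [V] for [|z - mu|], [S] for [sqrt pi], [p] for [pi], [I] for the convolution of the
    kernels. *)
Lemma ggd_constants (a b A B G H V S p I : R) : G != 0 -> H != 0 -> V != 0 -> S != 0 -> p != 0 ->
  a * A / (2 * G) * (b * B / (2 * H)) * I =
  S / (G * H * V) * ((4 * p ^+ 2)^-1 * (A * B * V / S * (a * p * (b * p) * I))).
Proof. by move=> G0 H0 V0 S0 p0; field; rewrite G0 H0 V0 S0 p0. Qed.

Lemma ln_sqr_inv (s g h v : R) : 0 < s -> 0 < g -> 0 < h -> v != 0 ->
  ln (s ^+ 2 * g / (h * v ^+ 2)) = - (2 * (ln (s^-1 * Num.sqrt (h / g)) + ln `|v|)).
Proof.
move=> s0 g0 h0 v0.
have V0 : 0 < `|v| by rewrite normr_gt0.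
have hg : 0 < h / g by rewrite divr_gt0.
have L0 : 0 < s^-1 * Num.sqrt (h / g) by rewrite mulr_gt0 ?invr_gt0// sqrtr_gt0.
rewrite ln_sqrM//.
have P0 : 0 < (s^-1 * Num.sqrt (h / g) * `|v|) ^+ 2 by rewrite exprn_gt0// mulr_gt0.
rewrite -lnV//; congr ln.
rewrite exprMn real_normK ?num_real// exprMn sqr_sqrtr ?ltW//.
by field; rewrite v0 !gt_eqF.
Qed.

Lemma ln_ggd_arg (sigma a v : R) : 0 < sigma -> 0 < Gamma (1 / a) -> 0 < Gamma (3 / a) ->
  v != 0 -> ln (sigma ^+ 2 * Gamma (1 / a) / (Gamma (3 / a) * v ^+ 2)) =
  - (2 * (ln (ggd_Lambda sigma a) + ln `|v|)).
Proof. exact: ln_sqr_inv. Qed.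
End GGD.

Theorem theorem3 (R : realType) (d : measure_display) (T : measurableType d)
  (P : probability T R) (X Y : {RV P >-> R})
  (alpha beta mu1 mu2 sigma1 sigma2 : R)
  (halpha : 0 < alpha) (hbeta : 0 < beta)
  (hsigma1 : 0 < sigma1) (hsigma2 : 0 < sigma2)
  (hX : has_density P X (ggd_pdf mu1 sigma1 alpha))
  (hY : has_density P Y (ggd_pdf mu2 sigma2 beta))
  (hXY : indep_RV P X Y) :
  let mu := mu1 + mu2 in
  exists fZ : R -> R,
    has_density P (fun w => X w + Y w) fZ /\
    forall c1 c2 : R, -(1/2) < c1 < 0 -> -(1/2) < c2 < 0 -> -(1/2) < c1 + c2 ->
    forall z : R, z != mu ->
      (fZ z)%:C =
      ((Num.sqrt pi / (Gamma (1 / alpha) * Gamma (1 / beta) * `|z - mu|))%:C *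
       G0 alpha beta c1 c2
         (sigma1 ^+ 2 * Gamma (1 / alpha) / (Gamma (3 / alpha) * (z - mu) ^+ 2))
         (sigma2 ^+ 2 * Gamma (1 / beta) / (Gamma (3 / beta) * (z - mu) ^+ 2)))%C.
Proof.
move=> mu.
have [g1 g3 L1] := ggd_pos hsigma1 halpha hX.
have [g1' g3' L2] := ggd_pos hsigma2 hbeta hY.
(* The convolution is defined without a contour, so one density serves for all admissible [c1],
   [c2]. *)
exists (fun z => rint (fun x => ggd_pdf mu1 sigma1 alpha x * ggd_pdf mu2 sigma2 beta (z - x))).
split.
  apply: (has_density_add _ _ _ _ _ hX hY hXY).
  - exact: meas_ggd_pdf.
  - exact: meas_ggd_pdf.
  - by move=> x; exact: ggd_pdf_ge0.
  - by move=> x; exact: ggd_pdf_ge0.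
  - by move=> x; exact: ggd_pdf_le.
move=> c1 c2 /andP[h1 h3] /andP[h2 h4] h5 z zmu.
set v := z - mu; have v0 : v != 0 by rewrite subr_eq0.
rewrite ggd_convolution// -/mu -/v /G0.
set I := rint _.
have nv : `|v| != 0 by rewrite normr_eq0.
set e := expR (ln (ggd_Lambda sigma1 alpha) + ln (ggd_Lambda sigma2 beta) + ln `|v|) / Num.sqrt pi.
have -> : cRint (fun t => cRint (fun tau => G0_integrand alpha beta
    (sigma1 ^+ 2 * Gamma (1 / alpha) / (Gamma (3 / alpha) * v ^+ 2))
    (sigma2 ^+ 2 * Gamma (1 / beta) / (Gamma (3 / beta) * v ^+ 2))
    (c1 +i* t)%C (c2 +i* tau)%C)) = (e%:C * (alpha * pi * (beta * pi) * I)%:C)%C.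
  rewrite (convolution_mellin _ _ halpha hbeta h1 h2 h3 h4 h5 v0).
  apply: eq_cRint => t; apply: eq_cRint => u; apply/esym.
  by apply: G0_integrandE => //; exact: ln_ggd_arg.
rewrite -!rmorphM; congr (_%:C)%C.
have -> : e = ggd_Lambda sigma1 alpha * ggd_Lambda sigma2 beta * `|v| / Num.sqrt pi.
  by rewrite /e expR_lnD3// normr_gt0.
have p0 : 0 < pi :> R by exact: pi_gt0.
have sp0 : Num.sqrt pi != 0 :> R by rewrite gt_eqF// sqrtr_gt0.
exact: (ggd_constants _ _ _ _ _ (lt0r_neq0 g1) (lt0r_neq0 g1') nv sp0 (lt0r_neq0 p0)).
Qed.
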